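(* Let $1<p<\infty$ and let $\psi\in\mathfrak{M}''_{\infty}$ be differentiable and such that $\frac{\psi(t)}{|\psi'(t)|}$ increases monotonically to $\infty$ as $t\to\infty$. Then for every $\beta\in\mathbb{R}$, $$e^{\bot}_{2n-1}(L^{\psi}_{\beta,p})_{\infty}\asymp e^{\bot}_{2n}(L^{\psi}_{\beta,p})_{\infty}\asymp \psi(n)\,(\eta(n)-n)^{1/p},\qquad n\in\mathbb{N}.$$
   Context: $L_p$ ($1\le p<\infty$) is the space of $2\pi$-periodic functions with $\|f\|_p=(\int_0^{2\pi}|f|^p)^{1/p}<\infty$; $L_\infty$ is the space of essentially bounded $2\pi$-periodic measurable functions with the ess sup norm. For $f\in L_1$, $\hat f(k)=\frac{1}{2\pi}\int_{-\pi}^{\pi}f(t)e^{-ikt}dt$. Given a sequence $\psi(k)$ and $\beta\in\mathbb{R}$, if $\sum_{k\in\mathbb{Z}\setminus\{0\}}\frac{\hat f(k)}{\psi(|k|)}e^{i(kx+\frac{\beta\pi}{2}\mathrm{sign}\,k)}$ is the Fourier series of some $\varphi\in L_1$, then $\varphi=:f^{\psi}_{\beta}$ is the $(\psi,\beta)$-derivative of $f$. Let $B^0_p=\{\varphi\in L_p:\|\varphi\|_p\le1,\ \int_{-\pi}^{\pi}\varphi=0\}$; the class $L^{\psi}_{\beta,p}$ is the set of $f$ whose $(\psi,\beta)$-derivative exists and belongs to $B^0_p$. $\mathfrak{M}$ is the set of convex (downward), continuous functions $\psi(t)$, $t\ge1$, with $\psi(t)\to0$ as $t\to\infty$; the sequence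 $\psi(k)$ defining the class is the restriction of $\psi\in\mathfrak{M}$ to $\mathbb{N}$. For $\psi\in\mathfrak{M}$, $\eta(t)=\eta(\psi;t)=\psi^{-1}(\psi(t)/2)$ and $\mu(t)=\mu(\psi;t)=\frac{t}{\eta(t)-t}$. $\mathfrak{M}^+_\infty=\{\psi\in\mathfrak{M}:\mu(\psi;t)\text{ increases monotonically to }\infty\}$, and $\mathfrak{M}''_\infty=\{\psi\in\mathfrak{M}^+_\infty:\exists K>0\text{ with }\eta(\psi;t)-t\ge K\ \forall t\ge1\}$. For $f\in L_1$, $1\le s\le\infty$, $m\in\mathbb{N}$: $e^{\bot}_m(f)_s=\inf_{\gamma_m}\|f-\sum_{k\in\gamma_m}\hat f(k)e^{ik\cdot}\|_s$, the infimum over all sets $\gamma_m$ of $m$ integers, and $e^{\bot}_m(L^{\psi}_{\beta,p})_s=\sup_{f\in L^{\psi}_{\beta,p}}e^{\bot}_m(f)_s$. $a_n\asymp b_n$ means $C_1a_n\le b_n\le C_2a_n$ for all $n$ with positive constants $C_1,C_2$ independent of $n$. *)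

(* Defs.v *)
From HB Require Import structures.
From mathcomp Require Import all_boot all_order all_algebra.
From mathcomp Require Import complex.
From mathcomp Require Import boolp classical_sets functions reals ereal topology.
From mathcomp Require Import normedtype sequences derive realfun exp trigo.
From mathcomp Require Import measure lebesgue_measure lebesgue_integral.
From mathcomp Require Import lebesgue_Rintegral.

Set Implicit Arguments.
Unset Strict Implicit.
Unset Printing Implicit Defensive.

Import Order.TTheory GRing.Theory Num.Theory.
Import numFieldNormedType.Exports.

Local Open Scope classical_set_scope.
Local Open Scope ring_scope.

Section Defs.
Variable R : realType.

Local Notation mu := (@lebesgue_measure R).

Definition periodic2pi (f : R -> R) : Prop := forall x, f (x + 2 * pi) = f x.

Definition inL1 (f : R -> R) : Prop :=
  [/\ periodic2pi f, measurable_fun setT f &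
      mu.-integrable `[0, 2 * pi] (EFin \o f)].

Definition intp (p : R) (f : R -> R) : \bar R :=
  (\int[mu]_(x in `[0%R, (2 * pi)%R]) (powR `|f x| p)%:E)%E.

Definition inLp (p : R) (f : R -> R) : Prop :=
  [/\ periodic2pi f, measurable_fun setT f & (intp p f < +oo)%E].

Definition cmod (z : R[i]) : R := ComplexField.Normc.normc z.
Definition expi (t : R) : R[i] := (cos t +i* sin t)%C.

(** Fourier coefficient hat f(k) = 1/(2pi) \int_{-pi}^{pi} f(t) e^{-ikt} dt,
    written through its real and imaginary parts *)
Definition fourier (f : R -> R) (k : int) : R[i] :=
  ((Rintegral mu `[- pi, pi] (fun t => f t * cos (k%:~R * t)) / (2 * pi)) -i*
   (Rintegral mu `[- pi, pi] (fun t => f t * sin (k%:~R * t)) / (2 * pi)))%C.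

Definition psi_beta_derivative (psi : R -> R) (beta : R) (f phi : R -> R) : Prop :=
  inL1 phi /\
  forall k : int, fourier phi k =
    if k == 0 then 0
    else fourier f k * (((psi `|k|%:R)^-1)%:C)%C * expi (beta * pi / 2 * (Num.sg k)%:~R).

Definition B0p (p : R) (phi : R -> R) : Prop :=
  [/\ inLp p phi, (intp p phi <= 1)%E &
      Rintegral mu `[- pi, pi] phi = 0].

Definition Lclass (psi : R -> R) (beta p : R) : set (R -> R) :=
  [set f | inL1 f /\ exists phi, psi_beta_derivative psi beta f phi /\ B0p p phi].

Definition supnorm (g : R -> R[i]) : \bar R :=
  ereal_inf [set y : \bar R |
    (\forall x \ae mu, x \in `[0, 2 * pi]%R -> ((cmod (g x))%:E <= y)%E)].

Definition fourier_rem (f : R -> R) (gamma : seq int) : R -> R[i] :=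
  fun x => ((f x)%:C)%C - \sum_(k <- gamma) fourier f k * expi (k%:~R * x).

Definition e_orth (m : nat) (f : R -> R) : \bar R :=
  ereal_inf [set supnorm (fourier_rem f gamma) |
             gamma in [set gamma : seq int | uniq gamma /\ size gamma = m]].

Definition e_orth_class (m : nat) (L : set (R -> R)) : \bar R :=
  ereal_sup [set e_orth m f | f in L].

Definition frakM (psi : R -> R) : Prop :=
  [/\ (forall t, 1 <= t -> 0 < psi t),
      (forall x y l, 1 <= x -> 1 <= y -> 0 <= l <= 1 ->
         psi (l * x + (1 - l) * y) <= l * psi x + (1 - l) * psi y),
      {within `[1, +oo[, continuous psi} &
      psi @ +oo --> 0].

Definition etaf (psi : R -> R) (t : R) : R :=
  xget 1 [set s | 1 <= s /\ psi s = psi t / 2].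

Definition mu_fun (psi : R -> R) (t : R) : R := t / (etaf psi t - t).

Definition incr_to_infty (g : R -> R) : Prop :=
  (forall s t, 1 <= s -> s <= t -> g s <= g t) /\ g @ +oo --> +oo.

Definition frakM_plus_infty (psi : R -> R) : Prop :=
  frakM psi /\ incr_to_infty (mu_fun psi).

Definition frakM_second_infty (psi : R -> R) : Prop :=
  frakM_plus_infty psi /\
  exists K : R, 0 < K /\ forall t, 1 <= t -> K <= etaf psi t - t.

Definition asymp (a : nat -> R) (b : nat -> \bar R) : Prop :=
  exists C1 C2 : R, [/\ 0 < C1, 0 < C2 &
    forall n : nat, (0 < n)%N ->
      ((C1 * a n)%:E <= b n)%E /\ (b n <= (C2 * a n)%:E)%E].

End Defs.

(* Main.v *)
(** Write l = eta(n) - n, so that psi halves over [n, n + l].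

    Upper bound: remove the frequencies |k| < n. The Fejer means of the tail of
    f are convolutions of phi with sums of a_k cos(ky - theta), n <= k <= N,
    whose coefficients a_k decrease, are O(psi(n)) and sum up to O(psi(n) l),
    since mu(t) -> infinity prevents eta(t) - t from growing as fast as psi
    decays. Abel summation bounds such a kernel by a multiple of
    psi(n) l / (1 + l |sin(y/2)|), whose L_q norm is O(psi(n) l^(1/p)) for the
    conjugate exponent q; Hoelder's inequality bounds the Fejer means uniformly,
    hence the tail itself almost everywhere.

    Lower bound: let f = c (1 + 2 sum_{k <= N} cos(kx)) with N close to eta(n).
    All 2N+1 coefficients of f are equal to c, so whichever m <= 2n of them are
    removed, the remainder is at least c (2N+1-2n) >= 2 c l at 0. The
    (psi,beta)-derivative of f has coefficients c / psi(|k|), which increase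
    with |k|; as ln psi is convex (this is the monotonicity of psi/|psi'|) they
    sum up to O(c l / psi(n)), and the same kernel estimate allows
    c ~ psi(n) l^(1/p - 1). *)

Require Import Defs.
From HB Require Import structures.
From mathcomp Require Import all_boot all_order all_algebra.
From mathcomp Require Import complex.
From mathcomp Require Import boolp classical_sets functions reals ereal topology.
From mathcomp Require Import normedtype sequences derive realfun exp trigo.
From mathcomp Require Import measure lebesgue_measure lebesgue_integral measurable_realfun ftc.
From mathcomp Require Import archimedean zify ring lra.

Set Implicit Arguments.
Unset Strict Implicit.
Unset Printing Implicit Defensive.

Import Order.TTheory GRing.Theory Num.Theory.
Import numFieldNormedType.Exports.
Local Open Scope classical_set_scope.
Local Open Scope ring_scope.

(** * The class of functions psi *)

(** A priori an f of the class is only integrable: neither its continuity nor the convergence of its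
    Fourier series is at hand, while the remainder must be bounded almost everywhere. Fejer means
    get round this. Their weights 1 - k/(N+1) are nonnegative and decreasing, so the damped kernels
    obey the same estimate as the undamped one, uniformly in N. The way back from the means to f
    goes through primitives: those of the Fejer kernels converge boundedly, so dominated convergence
    applies. Both bounds get the exponent 1/p from one integral: for every r > 1 the r-th power of 1
    / (1 + l |sin(y/2)|) integrates to O(1/l). With r = q the kernel has norm psi(n) l l^(-1/q) =
    psi(n) l^(1/p); with r = p the derivative of f has norm of order c l^(1 - 1/p) / psi(n), which
    dictates c. The lower bound K of eta(t) - t absorbs what does not scale with l: the rounding of
    l to an integer, and the frequency n that is removed on top of |k| < n when 2n frequencies are
    allowed, at the price O(psi(n)). *)

Lemma frakM_small (R : realType) (psi : R -> R) (e : R) :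
  frakM psi -> 0 < e -> exists M, forall u, M < u -> psi u < e.
Proof.
move=> [_ _ _ psi0] e0.
have /cvgrPdist_lt/(_ _ e0) := psi0.
move=> [M [_ HM]]; exists M => u /HM/=.
by rewrite sub0r normrN; exact/le_lt_trans/ler_norm.
Qed.

(** If psi(s) <= psi(t), then convexity at t, between s and a far point u, forces psi(u) >= psi(t) >
    0, against the limit 0. *)
Lemma frakM_decr (R : realType) (psi : R -> R) (s t : R) :
  frakM psi -> 1 <= s -> s < t -> psi t < psi s.
Proof.
move=> Hpsi s1 st; have [psi_gt0 conv _ _] := Hpsi.
rewrite ltNge; apply/negP => le_psi.
have t1 : 1 <= t by lra.
have [M HM] := frakM_small Hpsi (psi_gt0 t t1).
pose u := Num.max M t + 1.
have Mu : M < u by rewrite /u ltr_pwDr// le_max lexx.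
have tu : t < u by rewrite /u ltr_pwDr// le_max lexx orbT.
have := HM _ Mu; apply/negP; rewrite -leNgt.
pose l := (u - t) / (u - s).
have us : 0 < u - s by lra.
have l0 : 0 < l by rewrite divr_gt0//; lra.
have l1 : l < 1 by rewrite ltr_pdivrMr//; lra.
have tE : l * s + (1 - l) * u = t by rewrite /l; field; rewrite gt_eqF.
have := conv s u l s1 (le_trans t1 (ltW tu)).
rewrite tE (ltW l0) (ltW l1) => /(_ isT) h.
have : (1 - l) * psi t <= (1 - l) * psi u by nra.
by rewrite ler_pM2l// subr_gt0.
Qed.

Lemma frakM_nincr (R : realType) (psi : R -> R) (s t : R) :
  frakM psi -> 1 <= s -> s <= t -> psi t <= psi s.
Proof.
move=> Hpsi s1; rewrite le_eqVlt => /predU1P[->//|st].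
exact/ltW/frakM_decr.
Qed.

(** [etaf] is an [xget] choice, so it means something only once a solution exists; the intermediate
    value theorem gives one between t and a point where psi is below psi(t)/2. The definition of
    [etaf] is not unfolded again after this. *)
Lemma etafP (R : realType) (psi : R -> R) (t : R) :
  frakM psi -> 1 <= t -> 1 <= etaf psi t /\ psi (etaf psi t) = psi t / 2.
Proof.
move=> Hpsi t1; have [psi_gt0 _ psic _] := Hpsi.
have pt := psi_gt0 _ t1.
suff [s Hs] : exists s, 1 <= s /\ psi s = psi t / 2.
  exact: (@xgetPex _ 1 [set s0 | 1 <= s0 /\ psi s0 = psi t / 2] (ex_intro _ s Hs)).
have [M HM] := @frakM_small _ _ (psi t / 2) Hpsi ltac:(lra).
pose u := Num.max M t + 1.
have Mu : M < u by rewrite /u ltr_pwDr// le_max lexx.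
have tu : t < u by rewrite /u ltr_pwDr// le_max lexx orbT.
have pu := HM _ Mu.
have [||c] := @IVT R psi t u (psi t / 2) (ltW tu).
- apply: continuous_subspaceW psic => x /=; rewrite !in_itv/= => /andP[tx _].
  by rewrite andbT (le_trans t1).
- rewrite ge_min le_max (ltW pu) orbT/=.
  by apply/orP; left; lra.
- by rewrite in_itv/= => /andP[tc _] pc; exists c; split => //; lra.
Qed.

Section frakM_second.
Variables (R : realType) (psi : R -> R).
Hypothesis Hpsi : frakM_second_infty psi.

Lemma psi_frakM : frakM psi. Proof. by case: Hpsi => -[]. Qed.

Lemma psi_gt0 t : 1 <= t -> 0 < psi t.
Proof. by case: psi_frakM => h _ _ _; exact: h. Qed.

Lemma etaf_gap : exists2 K, 0 < K & forall t, 1 <= t -> K <= etaf psi t - t.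
Proof. by case: Hpsi => _ [K [K0 HK]]; exists K. Qed.

Lemma etaf_gt t : 1 <= t -> 0 < etaf psi t - t.
Proof. by case: etaf_gap => K K0 HK /HK; exact: lt_le_trans. Qed.

(** Since t + K <= eta(t), a step of length K costs psi at most a factor 2, and 2/K rounded up steps
    cover a distance 2. The offset 2 is the room needed by the index N + 1 in [extremal_kernel],
    which can exceed eta(n) by that much. *)
Lemma psi_shift : exists2 D, 0 < D &
  forall t, 1 <= t -> psi t <= D * psi (etaf psi t + 2).
Proof.
have [K K0 HK] := etaf_gap.
have step j t : 1 <= t -> psi t <= 2 ^+ j * psi (t + j%:R * K).
  elim: j t => [|j IH] t t1; first by rewrite mul0r addr0 expr0 mul1r.
  have tK : 1 <= t + K by lra.
  have := IH _ tK; rewrite -[j.+1]addn1 natrD mulrDl mul1r addn1 exprS.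
  rewrite [j%:R * K + K]addrC addrA -mulrA => h.
  apply: (le_trans _ (_ : 2 * psi (t + K) <= _)); last by rewrite ler_pM2l.
  have [e1 eE] := etafP psi_frakM t1.
  have := @frakM_nincr _ _ (t + K) (etaf psi t) psi_frakM tK.
  by have := HK _ t1 => ? /(_ ltac:(lra)); rewrite eE => ?; lra.
pose j := (Num.truncn (2 / K)).+1.
exists (2 * 2 ^+ j) => [|t t1]; first by rewrite mulr_gt0// exprn_gt0.
have [e1 eE] := etafP psi_frakM t1.
have -> : psi t = 2 * psi (etaf psi t) by rewrite eE; field.
rewrite -mulrA ler_pM2l//; apply: (le_trans (step j _ e1)).
rewrite ler_pM2l ?exprn_gt0//; apply: frakM_nincr; [exact: psi_frakM|lra|].
by rewrite lerD2l -ler_pdivrMr// ltW// truncnS_gt.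
Qed.

(* On [n, n + d], with d just above eta(n) - n, the value of psi halves, while
   the monotonicity of mu multiplies eta(n) - n by at most 3/2 as soon as
   mu(n) >= 4: the successive blocks are dominated by a geometric series of
   ratio 3/4. The finitely many other values of n only affect the constant. *)
Lemma tail_sum : exists2 C, 0 < C & forall n M, (0 < n)%N ->
  \sum_(n <= k < M) psi k%:R <= C * psi n%:R * (etaf psi n%:R - n%:R).
Proof.
have sub_dec (a b e i : nat) :
    (0 < e)%N -> (a - b < i.+1)%N -> (b + e < a)%N -> (a - (b + e) < i)%N.
  by lia.
have [K K0 HK] := etaf_gap.
have [[_ [mu_incr mu_infty]] _] := Hpsi.
have nat1 n : (0 < n)%N -> 1 <= n%:R :> R by rewrite ler1n.
(* From T on, n >= 4 l and n >= 4, hence d <= l + 1 <= n/2; monotonicity of mu then gives the ratio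
   (n + d)/n <= 3/2 for the gaps. *)
have [T [T0 HT]] : exists T : nat, (4 <= T)%N /\
    forall n, (T <= n)%N -> 4 * (etaf psi n%:R - n%:R) <= n%:R.
  have /cvgryPge/(_ 4)[M [_ HM]] := mu_infty.
  exists (maxn 4 (Num.truncn M).+1); split; first exact: leq_maxl.
  move=> n; rewrite geq_max => /andP[n4 Mn].
  have /HM/= : M < n%:R.
    by apply: (lt_le_trans (truncnS_gt M)); rewrite ler_nat.
  by rewrite /mu_fun ler_pdivlMr// etaf_gt// nat1// (leq_trans _ n4).
(* The solution of C1 = (1 + 1/K) + 3/4 C1: the first block costs (1 + 1/K) psi(n) l, the rest 1/2 *
   3/2 of the bound for n. *)
pose C1 := 4 * (1 + K^-1).
have C10 : 0 < C1 by rewrite mulr_gt0// addr_gt0// invr_gt0.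
have block n M : (0 < n)%N -> \sum_(n <= k < M) psi k%:R <= (M - n)%:R * psi n%:R.
  move=> n0; rewrite mulr_natl -sumr_const_nat !big_nat.
  apply: ler_sum => k /andP[nk kM]; apply: frakM_nincr; [exact: psi_frakM|exact: nat1|].
  by rewrite ler_nat.
have main n M : (T <= n)%N ->
    \sum_(n <= k < M) psi k%:R <= C1 * psi n%:R * (etaf psi n%:R - n%:R).
  have [j] := ubnP (M - n); elim: j n => // j IH n Mj Tn.
  have n0 : (0 < n)%N by rewrite (leq_trans _ Tn)// (leq_trans _ T0).
  have n1 := nat1 _ n0.
  set l := etaf psi n%:R - n%:R.
  have lK : K <= l by exact: HK.
  have ln : 4 * l <= n%:R by exact: HT.
  have n4 : 4 <= n%:R :> R by rewrite ler_nat (leq_trans T0).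
  have pn := psi_gt0 n1.
  pose d := (Num.truncn l).+1.
  have ld : l < d%:R by exact: truncnS_gt.
  have dl : d%:R <= l + 1.
    by rewrite /d -natr1 lerD2r truncn_le//; lra.
  have d_le : d%:R * psi n%:R <= (1 + K^-1) * psi n%:R * l.
    have : 1 <= K^-1 * l by rewrite mulrC ler_pdivlMr// mul1r.
    by move=> h; rewrite mulrAC ler_pM2r//; lra.
  have [Mnd|ndM] := leqP M (n + d).
    apply: (le_trans (block _ _ n0)).
    apply: (@le_trans _ _ (d%:R * psi n%:R)).
      by rewrite ler_pM2r// ler_nat leq_subLR.
    apply: (le_trans d_le); rewrite ler_pM2r ?etaf_gt// ler_pM2r// /C1.
    by have K1 : 0 < K^-1; [rewrite invr_gt0|lra].
  rewrite (big_cat_nat (n := n + d))/= ?leq_addr//; last exact: ltnW.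
  have nd1 : 1 <= (n + d)%:R :> R by rewrite ler1n addn_gt0 n0.
  have h1 := block n (n + d)%N n0; rewrite addKn in h1.
  have h2 := IH (n + d)%N (sub_dec _ _ _ _ (ltn0Sn _) Mj ndM)
              (leq_trans Tn (leq_addr _ _)).
  have pnd : psi (n + d)%:R <= psi n%:R / 2.
    have [_ <-] := etafP psi_frakM n1.
    apply: frakM_nincr; [exact: psi_frakM|exact: (etafP psi_frakM n1).1|].
    by rewrite natrD; move: ld; rewrite /l; lra.
  have lnd : etaf psi (n + d)%:R - (n + d)%:R <= 3 / 2 * l.
    have := mu_incr n%:R (n + d)%:R n1 ltac:(by rewrite ler_nat leq_addr).
    rewrite /mu_fun ler_pdivrMr ?etaf_gt// mulrAC ler_pdivlMr ?etaf_gt//.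
    rewrite -/l => h.
    rewrite -(ler_pM2l (_ : 0 < n%:R :> R)); last lra.
    apply: (le_trans h); rewrite natrD.
    by nra.
  apply: (le_trans (lerD h1 h2)).
  have : C1 * psi (n + d)%:R * (etaf psi (n + d)%:R - (n + d)%:R) <=
      C1 * (psi n%:R / 2) * (3 / 2 * l).
    apply: ler_pM => //.
    - by rewrite mulr_ge0// ltW// psi_gt0.
    - by rewrite ltW// etaf_gt.
    - by rewrite ler_pM2l.
  by rewrite /C1 in C10 *; nra.
clearbody C1.
have T1 : 1 <= T%:R :> R by rewrite ler1n (leq_trans _ T0).
have T00 : (0 < T)%N by rewrite (leq_trans _ T0).
have pT := psi_gt0 T1.
have p1 : 0 < psi 1 by exact: psi_gt0.
have lT := etaf_gt T1.
(* For n < T the whole sum is at most the constant [D], and psi(n) (eta(n) - n) >= psi(T) K brings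
   it to the required form. *)
pose D := T%:R * psi 1 + C1 * psi T%:R * (etaf psi T%:R - T%:R).
have D0 : 0 < D by rewrite addr_gt0// !mulr_gt0//; lra.
exists (C1 + D / (psi T%:R * K)) => [|n M n0].
  by rewrite addr_gt0// divr_gt0// mulr_gt0.
have n1 := nat1 _ n0; have pn := psi_gt0 n1; have ln := etaf_gt n1.
have [Tn|nT] := leqP T n.
  apply: (le_trans (main n M Tn)); rewrite !ler_pM2r//.
  by rewrite lerDl divr_ge0// ?mulr_ge0// ltW.
apply: (@le_trans _ _ D).
  have psi1 k : (0 < k)%N -> 0 <= psi k%:R by move=> k0; rewrite ltW// psi_gt0// nat1.
  have [MT|TM] := leqP M T.
    apply: (le_trans (block _ _ n0)).
    rewrite -[leLHS]addr0 lerD//; last by rewrite !mulr_ge0// ltW.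
    apply: ler_pM => //; first exact: ltW.
      by rewrite ler_nat (leq_trans (leq_subr _ _)).
    by apply: frakM_nincr => //; exact: psi_frakM.
  rewrite (big_cat_nat (n := T))/= ?(ltnW nT) ?(ltnW TM)//.
  rewrite lerD//; last exact: main.
  apply: (le_trans (block _ _ n0)).
  apply: ler_pM => //; first exact: ltW.
    by rewrite ler_nat leq_subr.
  by apply: frakM_nincr => //; exact: psi_frakM.
rewrite 2!mulrDl -[leLHS]add0r lerD//; first by rewrite !mulr_ge0// ltW.
rewrite -mulrA mulrAC ler_pdivlMr ?mulr_gt0// ler_pM2l//.
apply: ler_pM => //; try exact: ltW.
- by apply: frakM_nincr => //; [exact: psi_frakM|rewrite ler_nat ltnW].
- exact: HK.
Qed.

(** * Convexity of ln psi and sums of 1 / psi *)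

Hypothesis psi_derivable : forall t, 1 <= t -> derivable psi t 1.
Hypothesis Hlambda : incr_to_infty (fun t => psi t / `|derive1 psi t|).

(** The mean slope is written with psi / |psi'| because that is the quantity whose values at two
    mean points can be compared. The derivative at c is negative, not just nonpositive, since psi
    decreases strictly from s to t. *)
Lemma ln_psi_MVT s t : 1 <= s -> s < t -> exists c, [/\ s < c < t,
  0 < psi c / `|derive1 psi c| &
  ln (psi s) - ln (psi t) = (psi c / `|derive1 psi c|)^-1 * (t - s)].
Proof.
move=> s1 st.
pose df x := derive1 psi x / psi x.
have d (x : R) : 1 <= x -> is_derive x 1 (@ln R \o psi) (df x).
  move=> x1; have px := psi_gt0 x1.
  have dl := is_derive1_ln px.
  have dp : is_derive x 1 psi (derive1 psi x).
    by rewrite derive1E; apply: DeriveDef => //; exact: psi_derivable.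
  rewrite /df mulrC; exact: is_derive1_comp.
have [||c] := @MVT R (@ln R \o psi) df s t st.
- by move=> x; rewrite in_itv/= => /andP[sx _]; apply: d; lra.
- apply: derivable_within_continuous => x; rewrite in_itv/= => /andP[sx _].
  by apply: ex_derive; apply: d; lra.
rewrite in_itv/= => /andP[sc ct] /= E; exists c.
have c1 : 1 <= c by lra.
have pc := psi_gt0 c1.
have d0 : derive1 psi c < 0.
  have : ln (psi t) < ln (psi s).
    rewrite ltr_ln ?posrE ?psi_gt0//; last lra.
    by apply: frakM_decr => //; exact: psi_frakM.
  by rewrite -subr_lt0 E pmulr_llt0 ?subr_gt0// /df pmulr_llt0 ?invr_gt0.
split; first by rewrite sc.
  by rewrite divr_gt0// normr_gt0 lt_eqF.
rewrite -opprB E invf_div /df ltr0_norm//; ring.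
Qed.

(** The rate of decay |psi'| / psi is nonincreasing, so ln psi falls on [s, t] at least as fast as
    on [u, eta(u)], which lies to the right and where it loses exactly ln 2. *)
Lemma ln_psi_slope (s t u : R) : 1 <= s -> s < t -> t <= u ->
  ln 2 * (t - s) / (etaf psi u - u) <= ln (psi s) - ln (psi t).
Proof.
move=> s1 st tu; have u1 : 1 <= u by lra.
have lu := etaf_gt u1.
have [c [/andP[sc ct] c0 ->]] := ln_psi_MVT s1 st.
have ueta : u < etaf psi u by rewrite -subr_gt0.
have [e [/andP[ue ee] e0]] := ln_psi_MVT u1 ueta.
have pu := psi_gt0 u1.
have [_ etaE] := etafP psi_frakM u1.
rewrite etaE ln_div ?posrE// opprB addrCA subrr addr0 => ->.
rewrite mulrAC mulfK ?gt_eqF//.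
rewrite ler_pM2r ?subr_gt0// lef_pV2 ?posrE//.
by have [mono _] := Hlambda; apply: mono; lra.
Qed.

(* By [ln_psi_slope], 1 / psi(k) is at most l / ln 2 times the increment
   1 / psi(k+1) - 1 / psi(k), so the sum telescopes. *)
Lemma sum_inv_psi n : (0 < n)%N ->
  \sum_(1 <= k < n) (psi k%:R)^-1 <= (etaf psi n%:R - n%:R) / ln 2 / psi n%:R.
Proof.
move=> n0; have n1 : 1 <= n%:R :> R by rewrite ler1n.
set l := etaf psi n%:R - n%:R; have l0 : 0 < l by exact: etaf_gt.
have ln20 : 0 < ln 2 :> R by rewrite ln_gt0// ltr1n.
have p1 : 0 < psi 1 by exact: psi_gt0.
suff : \sum_(1 <= k < n) (psi k%:R)^-1 <=
    \sum_(1 <= k < n) l / ln 2 * ((psi k.+1%:R)^-1 - (psi k%:R)^-1).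
  move=> /le_trans; apply; rewrite -mulr_sumr telescope_sumr//.
  rewrite ler_pM2l ?divr_gt0// lerBlDr lerDl invr_ge0//; exact/ltW.
rewrite !big_nat; apply: ler_sum => k /andP[k0 kn].
have k1 : 1 <= k%:R :> R by rewrite ler1n.
have k2 : 1 <= k.+1%:R :> R by rewrite ler1n.
have pk := psi_gt0 k1; have pk1 := psi_gt0 k2.
have /(_ ltac:(by rewrite ltr_nat) ltac:(by rewrite ler_nat)) :=
  @ln_psi_slope k%:R k.+1%:R n%:R k1.
have -> : k.+1%:R - k%:R = 1 :> R by rewrite -addn1 natrD addrC addKr.
rewrite -/l -ln_div ?posrE// mulr1 => h.
(* ln(1 + x) <= x with 1 + x = psi(k) / psi(k+1) turns an increment of ln psi into one of 1 /
   psi. *)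
have : ln 2 / l <= psi k%:R / psi k.+1%:R - 1.
  apply: (le_trans h); set a := _ / _.
  have a1 : -1 < a - 1 by rewrite ltrBrDr addrC subrr divr_gt0.
  by have := le_ln1Dx a1; rewrite addrC subrK.
move=> h2.
have -> : (psi k.+1%:R)^-1 - (psi k%:R)^-1 =
    (psi k%:R)^-1 * (psi k%:R / psi k.+1%:R - 1).
  by field; rewrite !gt_eqF.
rewrite mulrCA ler_peMr// ?invr_ge0; first exact: ltW.
by rewrite mulrAC ler_pdivlMr// mul1r -ler_pdivrMl// mulrC.
Qed.

End frakM_second.

(** * Trigonometric kernels *)

(** Summation by parts. The differences of a bounded s are the shape in which cosines arrive once
    multiplied by 2 sin(y/2), see [sin_half_cos]. *)
Lemma abel_sum_bound (R : realType) (a s : nat -> R) m N : (m <= N)%N ->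
  (forall k, `|s k| <= 1) ->
  `|\sum_(m <= k < N) a k * (s k.+1 - s k)| <=
  `|a m| + `|a N| + \sum_(m <= k < N) `|a k.+1 - a k|.
Proof.
move=> mN s1.
(* With the boundary term on the left, passing from N to N + 1 adds only (a N - a N.+1) * s N.+1,
   and the induction closes. *)
suff : `|\sum_(m <= k < N) a k * (s k.+1 - s k) - a N * s N| <=
    `|a m| + \sum_(m <= k < N) `|a k.+1 - a k|.
  have as1 : `|a N * s N| <= `|a N| by rewrite normrM ler_piMr.
  move=> h; rewrite addrAC -[X in `|X|](subrK (a N * s N)).
  by apply: (le_trans (ler_normD _ _)); exact: lerD.
have as1 k j : `|a k * s j| <= `|a k| by rewrite normrM ler_piMr.
elim: N mN => [|N IH]; first by rewrite leqn0 => /eqP->; rewrite !big_geq// sub0r normrN addr0.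
rewrite leq_eqVlt => /predU1P[->|mN]; first by rewrite !big_geq// sub0r normrN addr0.
rewrite !big_nat_recr//=; set S := \sum_(m <= k < N) a k * (s k.+1 - s k) in IH *.
have -> : S + a N * (s N.+1 - s N) - a N.+1 * s N.+1 =
   (S - a N * s N) + (a N - a N.+1) * s N.+1 by ring.
apply: (le_trans (ler_normD _ _)); rewrite addrA lerD//; first exact: IH.
by rewrite normrM distrC ler_piMr.
Qed.

Lemma sum_norm_diff_mono (R : realType) (a : nat -> R) m N : (m <= N)%N ->
  (forall k, (m <= k < N)%N -> a k <= a k.+1) \/
  (forall k, (m <= k < N)%N -> a k.+1 <= a k) ->
  \sum_(m <= k < N) `|a k.+1 - a k| = `|a N - a m|.
Proof.
move=> mN [up|dn].
- rewrite (eq_big_nat _ _ (F2 := fun k => a k.+1 - a k)) => [|k km].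
    rewrite telescope_sumr// ger0_norm// subr_ge0.
    elim: N mN up => [|N IH]; first by rewrite leqn0 => /eqP->.
    rewrite leq_eqVlt => /predU1P[->//|mN] up.
    by apply: (le_trans (IH mN _) (up N _)) => [k ?|]; [apply: up|]; lia.
  by rewrite ger0_norm// subr_ge0 up.
- rewrite (eq_big_nat _ _ (F2 := fun k => - a k.+1 - - a k)) => [|k km].
    rewrite (telescope_sumr (fun k => - a k))// opprK ler0_norm ?opprB 1?addrC//.
    rewrite addrC subr_le0.
    elim: N mN dn => [|N IH]; first by rewrite leqn0 => /eqP->.
    rewrite leq_eqVlt => /predU1P[->//|mN] dn.
    by apply: (le_trans (dn N _) (IH mN _)) => [|k ?]; [|apply: dn]; lia.
  by rewrite ler0_norm ?subr_le0 ?dn// opprB opprK addrC.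
Qed.

Lemma sin_half_cos (R : realType) (k : nat) (y t : R) :
  2 * sin (y / 2) * cos (k%:R * y + t) =
  sin ((k.+1%:R - 2^-1) * y + t) - sin ((k%:R - 2^-1) * y + t).
Proof.
have -> : (k.+1%:R - 2^-1) * y + t = (k%:R * y + t) + y / 2.
  by rewrite -addn1 natrD; field.
have -> : (k%:R - 2^-1) * y + t = (k%:R * y + t) - y / 2 by field.
by rewrite sinD sinB; ring.
Qed.

(** The trivial bound gives |K| <= B L. Abel summation gives 2 |sin(y/2)| |K| <= a m + a N + |a N -
    a m|, which is twice the larger end coefficient, hence at most 2 B. The first bound plus L times
    the second is the claim, valid for both directions of monotonicity. *)
Lemma monotone_kernel_bound (R : realType) (a : nat -> R) m N (B L t y : R) :
  (m <= N)%N -> 0 <= L ->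
  (forall k, (m <= k <= N)%N -> 0 <= a k <= B) ->
  (forall k, (m <= k < N)%N -> a k <= a k.+1) \/
  (forall k, (m <= k < N)%N -> a k.+1 <= a k) ->
  \sum_(m <= k < N) a k <= B * L ->
  `|\sum_(m <= k < N) a k * cos (k%:R * y + t)| * (1 + L * `|sin (y / 2)|) <=
  2 * B * L.
Proof.
move=> mN L0 aB mono aS; set K := \sum_(m <= k < N) a k * cos (k%:R * y + t).
have K1 : `|K| <= B * L.
  apply: le_trans aS; apply: (le_trans (ler_norm_sum _ _ _)).
  rewrite !big_nat; apply: ler_sum => k /andP[mk kN].
  have /andP[a0 _] := aB k ltac:(by rewrite mk ltnW).
  by rewrite normrM ger0_norm// ler_piMr// cos_max.
have K2 : `|K| * `|sin (y / 2)| <= B.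
  have := @abel_sum_bound R a (fun k => sin ((k%:R - 2^-1) * y + t)) m N mN
    (fun k => sin_max _).
  rewrite sum_norm_diff_mono//.
  under eq_big_nat => k _ do rewrite -sin_half_cos mulrCA.
  rewrite -mulr_sumr -/K 2!normrM ger0_norm//.
  have /andP[am aBm] := aB m ltac:(by rewrite leqnn).
  have /andP[aN aBN] := aB N ltac:(by rewrite leqnn andbT).
  rewrite (ger0_norm am) (ger0_norm aN) => h.
  have : `|a N - a m| <= 2 * B - a m - a N by rewrite ler_norml; apply/andP; split; lra.
  by move: h; rewrite mulrC mulrA mulrC => h1 h2; lra.
rewrite mulrDr mulr1; have -> : 2 * B * L = B * L + B * L by ring.
by rewrite lerD// mulrCA [leRHS]mulrC ler_wpM2l.
Qed.

Lemma is_derive_sumr (R : realType) (I : Type) (r : seq I) (f : I -> R -> R)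
    (df : I -> R) (x : R) :
  (forall i, is_derive x 1 (f i) (df i)) ->
  is_derive x 1 (fun y => \sum_(i <- r) f i y) (\sum_(i <- r) df i).
Proof.
move=> H; elim: r => [|i r IH].
  rewrite big_nil (_ : (fun y => _) = cst 0); first exact: is_derive_cst.
  by apply/funext => y; rewrite big_nil.
rewrite big_cons.
rewrite (_ : (fun y => _) = f i + (fun y => \sum_(i <- r) f i y)).
  exact: is_deriveD.
by apply/funext => y; rewrite big_cons.
Qed.

Lemma is_derive_affine (R : realType) (c t x : R) :
  is_derive x 1 (fun y : R => c * y + t) c.
Proof.
have := is_deriveD (is_deriveZ c (is_derive_id x (1 : R))) (is_derive_cst t x 1).
by rewrite addr0 /GRing.scale/= mulr1.
Qed.

Lemma is_derive_sin_affine (R : realType) (c t x : R) :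
  is_derive x 1 (fun y : R => sin (c * y + t)) (c * cos (c * x + t)).
Proof.
rewrite mulrC.
exact: (@is_derive1_comp R (@sin R) (fun y => c * y + t) x _ _
  (is_derive_sin (c * x + t)) (is_derive_affine c t x)).
Qed.

Lemma is_derive_cos_affine (R : realType) (c t x : R) :
  is_derive x 1 (fun y : R => cos (c * y + t)) (- c * sin (c * x + t)).
Proof.
rewrite mulNr -mulrN mulrC.
exact: (@is_derive1_comp R (@cos R) (fun y => c * y + t) x _ _
  (is_derive_cos (c * x + t)) (is_derive_affine c t x)).
Qed.

Lemma is_derive_scale (R : realType) (c : R) (f : R -> R) (x df : R) :
  is_derive x 1 f df -> is_derive x 1 (fun y => c * f y) (c * df).
Proof. by move=> h; exact: (is_deriveZ c h). Qed.

(** * The Fejer kernel and its primitive *)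

Section fejer.
Variable R : realType.
Implicit Types (N : nat) (y : R).

Definition fejer N y : R :=
  1 + \sum_(1 <= k < N.+1) 2 * (1 - k%:R / N.+1%:R) * cos (k%:R * y).

(* The primitive of the Fejer kernel vanishing at 0; it tends to the sawtooth
   function, equal to pi on ]0, 2 pi[. *)
Definition fejer_prim N y : R :=
  y + \sum_(1 <= k < N.+1) 2 * (1 - k%:R / N.+1%:R) / k%:R * sin (k%:R * y).

Let Csum N y : R := \sum_(0 <= k < N) cos (k%:R * y).
Let Ssum N y : R := \sum_(0 <= k < N) sin (k%:R * y).

(** This is the cross term that appears when one more exponential enters the square in [fejerE]; the
    sum is reversed to turn cos((N - k) y) into cos(k y). *)
Lemma Csum_Ssum N y : Csum N y * cos (N%:R * y) + Ssum N y * sin (N%:R * y) =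
  \sum_(1 <= k < N.+1) cos (k%:R * y).
Proof.
rewrite /Csum /Ssum !mulr_suml -big_split/= big_nat_rev/= add0n.
rewrite big_add1/= !big_nat; apply: eq_bigr => k /andP[_ kN].
rewrite [X in X + _]mulrC [X in _ + X]mulrC -cosB -mulrBl -natrB ?leq_subr//.
by rewrite subKn.
Qed.

(* (N+1) times the Fejer kernel is |sum_{k <= N} e^(iky)|^2. *)
Lemma fejerE N y : N.+1%:R * fejer N y = Csum N.+1 y ^+ 2 + Ssum N.+1 y ^+ 2.
Proof.
have N0 : N.+1%:R != 0 :> R by rewrite pnatr_eq0.
have -> : N.+1%:R * fejer N y =
    N.+1%:R + \sum_(1 <= k < N.+1) 2 * (N.+1%:R - k%:R) * cos (k%:R * y).
  rewrite /fejer mulrDr mulr1 mulr_sumr; congr (_ + _).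
  by apply: eq_bigr => k _; field.
clear N0; elim: N => [|N IH].
  by rewrite big_geq// /Csum /Ssum !big_nat1 mul0r cos0 sin0 expr1n expr0n/= !addr0.
have -> : Csum N.+2 y = Csum N.+1 y + cos (N.+1%:R * y) by rewrite /Csum big_nat_recr.
have -> : Ssum N.+2 y = Ssum N.+1 y + sin (N.+1%:R * y) by rewrite /Ssum big_nat_recr.
have -> : (Csum N.+1 y + cos (N.+1%:R * y)) ^+ 2 + (Ssum N.+1 y + sin (N.+1%:R * y)) ^+ 2
   = (Csum N.+1 y ^+ 2 + Ssum N.+1 y ^+ 2) +
     2 * (Csum N.+1 y * cos (N.+1%:R * y) + Ssum N.+1 y * sin (N.+1%:R * y)) +
     (cos (N.+1%:R * y) ^+ 2 + sin (N.+1%:R * y) ^+ 2) by ring.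
rewrite -IH Csum_Ssum cos2Dsin2 mulr_sumr.
have -> : \sum_(1 <= k < N.+2) 2 * (N.+2%:R - k%:R) * cos (k%:R * y) =
  \sum_(1 <= k < N.+1) 2 * (N.+1%:R - k%:R) * cos (k%:R * y) +
  \sum_(1 <= k < N.+2) 2 * cos (k%:R * y).
  rewrite !(big_nat_recr N.+1)//= addrA -big_split/=; congr (_ + _).
    by apply: eq_bigr => k _; rewrite -[N.+2]addn1 natrD; ring.
  by rewrite -[N.+2]addn1 natrD; ring.
by rewrite -[N.+2]addn1 natrD; ring.
Qed.

Lemma fejer_ge0 N y : 0 <= fejer N y.
Proof.
have : 0 <= N.+1%:R * fejer N y by rewrite fejerE addr_ge0// sqr_ge0.
by rewrite pmulr_rge0.
Qed.

Lemma fejer_le N y : fejer N y * sin (y / 2) ^+ 2 <= 2 / N.+1%:R.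
Proof.
(* Multiplied by 2 sin(y/2) the sum telescopes to a difference of two sines. The phase t = 0 gives
   [Csum] and t = - pi/2 gives [Ssum]. *)
have b t : (\sum_(0 <= k < N.+1) cos (k%:R * y + t)) ^+ 2 * sin (y / 2) ^+ 2 <= 1.
  rewrite -exprMn -real_normK ?num_real// exprn_ile1//.
  suff : `|2 * sin (y / 2) * \sum_(0 <= k < N.+1) cos (k%:R * y + t)| <= 2.
    by rewrite -mulrA normrM ger0_norm// [sin _ * _]mulrC; lra.
  rewrite mulr_sumr; under eq_bigr do rewrite sin_half_cos.
  rewrite (telescope_sumr (fun k : nat => sin ((k%:R - 2^-1) * y + t)))//.
  by apply: (le_trans (ler_normB _ _)); rewrite -[2]/(1 + 1) lerD// sin_max.
rewrite ler_pdivlMr// mulrC mulrA fejerE mulrDl -[2]/(1 + 1) lerD//.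
- by have := b 0; under eq_bigr do rewrite addr0.
- have := b (- (pi / 2)); under eq_bigr do rewrite cosB cos_pihalf sin_pihalf mulr0 add0r mulr1.
  by [].
Qed.

Lemma is_derive_fejer_prim N y : is_derive y 1 (fejer_prim N) (fejer N y).
Proof.
apply: is_deriveD.
under eq_big_nat => k /andP[k0 _].
  have -> : 2 * (1 - k%:R / N.+1%:R) * cos (k%:R * y) =
    2 * (1 - k%:R / N.+1%:R) / k%:R * (k%:R * cos (k%:R * y)).
    by rewrite mulrA divfK// pnatr_eq0 -lt0n.
  over.
apply: is_derive_sumr => k; apply: is_derive_scale.
by have := is_derive_sin_affine k%:R 0 y; under eq_fun do rewrite addr0; rewrite addr0.
Qed.

Lemma fejer_prim_homo N : {homo fejer_prim N : x y / x <= y}.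
Proof.
move=> x y; rewrite le_eqVlt => /predU1P[->//|xy].
have [||c _] := @MVT R (fejer_prim N) (fejer N) x y xy.
- by move=> z _; exact: is_derive_fejer_prim.
- apply: derivable_within_continuous => z _; apply: ex_derive.
  exact: is_derive_fejer_prim.
- by move=> E; rewrite -subr_ge0 E mulr_ge0 ?fejer_ge0// subr_ge0 ltW.
Qed.

Lemma fejer_primN N y : fejer_prim N (- y) = - fejer_prim N y.
Proof.
rewrite /fejer_prim opprD -sumrN; congr (_ + _); apply: eq_bigr => k _.
by rewrite mulrN sinN mulrN.
Qed.

Lemma sin_nat_pi (k : nat) : sin (k%:R * pi) = 0 :> R.
Proof.
elim: k => [|k IH]; first by rewrite mul0r sin0.
by rewrite -addn1 natrD mulrDl mul1r sinDpi IH oppr0.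
Qed.

Lemma sinD2pi_nat (k : nat) y : sin (k%:R * (y + 2 * pi)) = sin (k%:R * y).
Proof.
rewrite mulrDr; elim: k => [|k IH]; first by rewrite !mul0r addr0.
have -> : k.+1%:R * y + k.+1%:R * (2 * pi) = (k%:R * (2 * pi) + k.+1%:R * y) + pi *+ 2.
  by rewrite mulr2n -[k.+1]addn1 natrD; ring.
rewrite sinD2pi sinD.
have -> : k%:R * (2 * pi) = (2 * k)%:R * pi :> R by rewrite natrM; ring.
rewrite sin_nat_pi mul0r add0r.
suff -> : cos ((2 * k)%:R * pi) = 1 :> R by rewrite mul1r.
clear IH; elim: k => [|k IH]; first by rewrite muln0 mul0r cos0.
have -> : (2 * k.+1)%:R * pi = ((2 * k)%:R * pi + pi) + pi :> R.
  by rewrite mulnS natrD; ring.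
by rewrite !cosDpi opprK.
Qed.

Lemma fejer_primD2pi N y : fejer_prim N (y + 2 * pi) = fejer_prim N y + 2 * pi.
Proof.
rewrite /fejer_prim addrAC; congr (_ + _ + _).
by apply: eq_bigr => k _; rewrite sinD2pi_nat.
Qed.

Lemma fejer_prim_pi N : fejer_prim N pi = pi.
Proof. by rewrite /fejer_prim big1 ?addr0// => k _; rewrite sin_nat_pi mulr0. Qed.

Lemma fejer_prim0 N : fejer_prim N 0 = 0.
Proof. by rewrite /fejer_prim big1 ?addr0// => k _; rewrite mulr0 sin0 mulr0. Qed.

(** Being monotone, the primitive lies between its values at -2 pi and 2 pi, which do not depend on
    N. This is the domination used in [P_cvg]. *)
Lemma fejer_prim_le2pi N y : `|y| <= 2 * pi -> `|fejer_prim N y| <= 2 * pi.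
Proof.
have H : fejer_prim N (2 * pi) = 2 * pi.
  by rewrite -[X in fejer_prim _ X]add0r fejer_primD2pi fejer_prim0 add0r.
rewrite !ler_norml => /andP[y1 y2].
rewrite -{1}H -fejer_primN -[X in _ && (_ <= X)]H.
by rewrite !fejer_prim_homo.
Qed.

(** The primitive equals pi at pi for every N, and on [y, pi] the kernel is O(1 / (N sin^2(y/2)));
    the mean value theorem gives the rest. *)
Lemma fejer_prim_bound N y : 0 < y <= pi ->
  `|fejer_prim N y - pi| <= 2 * pi / sin (y / 2) ^+ 2 / N.+1%:R.
Proof.
have pi0 := pi_gt0 R.
move=> /andP[y0]; rewrite le_eqVlt => /predU1P[->|ypi].
  by rewrite fejer_prim_pi subrr normr0 divr_ge0// divr_ge0 ?sqr_ge0// mulr_ge0// pi_ge0.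
rewrite -{1}(fejer_prim_pi N) distrC.
have [||c] := @MVT R (fejer_prim N) (fejer N) y pi ypi.
- by move=> z _; exact: is_derive_fejer_prim.
- apply: derivable_within_continuous => z _; apply: ex_derive.
  exact: is_derive_fejer_prim.
rewrite in_itv/= => /andP[yc cpi] ->.
have s0 : 0 < sin (y / 2) by apply: sin_gt0_pi; rewrite divr_gt0//=; lra.
have sc : sin (y / 2) < sin (c / 2).
  by rewrite ltr_sin ?in_itv/=; [lra|apply/andP; split; lra|apply/andP; split; lra].
have c0 : 0 < sin (c / 2) by lra.
have s2 : sin (y / 2) ^+ 2 <= sin (c / 2) ^+ 2 by rewrite ler_pXn2r// ?nnegrE ltW.
have h := fejer_le N c; have f0 := fejer_ge0 N c.
rewrite ger0_norm; last by rewrite mulr_ge0// subr_ge0 ltW.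
rewrite [leRHS](_ : _ = 2 / N.+1%:R / sin (y / 2) ^+ 2 * pi); last by field; rewrite !gt_eqF.
apply: ler_pM => //; [by rewrite subr_ge0 ltW| |lra].
rewrite ler_pdivlMr ?exprn_gt0//; apply: le_trans h.
by rewrite ler_wpM2l.
Qed.

Lemma cvg_inv_nat (c : R) : (fun N => c / N.+1%:R) @ \oo --> (0 : R).
Proof.
rewrite -[X in _ --> X](mulr0 c); apply: cvgM; first exact: cvg_cst.
exact: cvg_harmonic.
Qed.

Lemma fejer_prim_cvg y : 0 < y < 2 * pi -> fejer_prim N y @[N --> \oo] --> (pi : R).
Proof.
wlog ypi : y / y <= pi => [H|] /andP[y0 y2].
  have [ypi|ypi] := leP y pi; first by apply: H => //; rewrite y0.
  have -> : (fun N => fejer_prim N y) = (fun N => 2 * pi - fejer_prim N (2 * pi - y)).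
    apply/funext => N; have -> : 2 * pi - y = - y + 2 * pi by ring.
    by rewrite fejer_primD2pi fejer_primN; ring.
  rewrite -[X in _ --> X](_ : 2 * pi - pi = pi); last by ring.
  apply: cvgB; first exact: cvg_cst.
  by apply: H; [lra|apply/andP; split; lra].
apply/cvgrPdist_le => e e0.
have /cvgrPdist_le/(_ _ e0) := cvg_inv_nat (2 * pi / sin (y / 2) ^+ 2).
apply: filterS => N; rewrite sub0r normrN distrC => h.
apply: (le_trans (fejer_prim_bound N (y := y) _)); first by rewrite y0.
exact: (le_trans (ler_norm _)).
Qed.

End fejer.

(** * Integrals of kernels and translation invariance *)

(** With w = u/2 <= pi/4, both cos w and sin w / w are at least c = cos(pi/4), so sin u = 2 sin w
    cos w >= 2 w c^2 = w. *)
Lemma sin_ge_half (R : realType) (u : R) : 0 <= u <= pi / 2 -> u / 2 <= sin u.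
Proof.
have pi0 := pi_gt0 R.
move=> /andP[u0 u1]; pose w := u / 2; pose c : R := cos (pi / 2 / 2).
have cc : c ^+ 2 = 2^-1.
  have := cos_mulr2n (pi / 2 / 2 : R).
  by rewrite -[_ *+ 2]mulr_natr divfK// cos_pihalf -/c mulr2n; lra.
have c0 : 0 <= c by apply: cos_ge0_pihalf; apply/andP; split; lra.
have cosc x : 0 <= x <= pi / 2 / 2 -> c <= cos x.
  move=> /andP[x0 x1]; rewrite leNgt; apply/negP => h.
  have /ltr_cos : (pi / 2 / 2 : R) \in `[0, pi]%R by rewrite in_itv/=; apply/andP; split; lra.
  move=> /(_ x); rewrite in_itv/= => /(_ ltac:(apply/andP; split; lra)).
  by move=> E; move: h; rewrite /c E; lra.
have w0 : 0 <= w by rewrite /w; lra.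
have sw : w * c <= sin w.
  have := w0; rewrite le_eqVlt => /predU1P[<-|w0']; first by rewrite mul0r sin0.
  have [|d] := @MVT R sin cos 0 w w0'.
    by apply: continuous_subspaceT; exact: continuous_sin.
  rewrite in_itv/= => /andP[d0 dw]; rewrite sin0 !subr0 => ->.
  by rewrite mulrC ler_pM2r// cosc//; rewrite /w in dw; apply/andP; split; lra.
have cw : c <= cos w by apply: cosc; rewrite /w; apply/andP; split; lra.
have -> : sin u = 2 * (sin w * cos w).
  have -> : u = w *+ 2 by rewrite /w -[RHS]mulr_natr divfK.
  by rewrite sin_mulr2n -mulr_natr; ring.
have : w * c * c <= sin w * cos w by apply: ler_pM => //; rewrite mulr_ge0.
by rewrite -mulrA -expr2 cc /w; lra.
Qed.

Lemma continuous_sin_half (R : realType) : continuous (fun s : R => `|sin (s / 2)|).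
Proof.
move=> s; apply: cvg_norm; apply: (@continuous_comp _ _ _ (fun s : R => s / 2) (@sin R)).
  by apply: cvgM; [exact: cvg_id|exact: cvg_cst].
exact: continuous_sin.
Qed.

Section integrals.
Variable R : realType.

Lemma measurable_fun_powR (D : set R) (r : R) (f : R -> R) : measurable_fun D f ->
  measurable_fun D (fun x => f x `^ r).
Proof. by move=> mf; exact: (measurableT_comp (measurable_powR r) mf). Qed.

Local Notation mu := (@lebesgue_measure R).

Definition addl (c x : R) : R := x + c.

Lemma measurable_addl c : measurable_fun setT
  (addl c : measurableTypeR R -> measurableTypeR R).
Proof. exact: measurable_funD. Qed.

Lemma addl_itv (c a b : R) : addl c @^-1` `[a, b] = `[a - c, b - c]%classic.
Proof.
by apply/seteqP; split => x /=; rewrite !in_itv/= /addl lerBlDr lerBrDr.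
Qed.

Lemma lebesgue_measure_addl c (A : set R) : measurable A ->
  pushforward mu (addl c : _ -> measurableTypeR R) A = mu A.
Proof.
move=> mA; apply/esym/lebesgue_measure_unique => //=; first exact: measurable_addl.
move=> _ _ [[a b]] _ <-; rewrite /pushforward.
rewrite (_ : addl c @^-1` _ = `]a - c, b - c]%classic).
  rewrite !lebesgue_measure_itv/= !lte_fin ltrD2r -!EFinB.
  by rewrite (_ : b - c - (a - c) = b - a)//; ring.
by apply/seteqP; split => x /=; rewrite !in_itv/= /addl ltrBlDr lerBrDr.
Qed.

Lemma ge0_integral_addl c (a b : R) (f : R -> R) : measurable_fun setT f ->
  (forall x, 0 <= f x) ->
  (\int[mu]_(x in `[a, b]) (f x)%:E =
   \int[mu]_(x in `[(a - c)%R, (b - c)%R]) (f (x + c)%R)%:E)%E.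
Proof.
move=> mf f0.
have mE : measurable_fun `[a, b] (EFin \o f).
  by apply/measurable_EFinP; exact: measurable_funTS.
rewrite (_ : `[a - c, b - c]%classic =
    (addl c : _ -> measurableTypeR R) @^-1` `[a, b]); last by rewrite addl_itv.
rewrite -(@ge0_integral_pushforward _ _ _ _ _ _ (measurable_addl c) mu _ (EFin \o f))//.
  apply: eq_measure_integral => /=; first exact: measurable_addl.
  by move=> mm A mA AS; exact/esym/lebesgue_measure_addl.
by move=> x _; rewrite lee_fin.
Qed.

Lemma ge0_integral_itv_cat (a b c : R) (f : R -> R) : measurable_fun setT f ->
  (forall x, 0 <= f x) -> a <= b -> b <= c ->
  (\int[mu]_(x in `[a, c]) (f x)%:E =
   \int[mu]_(x in `[a, b]) (f x)%:E + \int[mu]_(x in `[b, c]) (f x)%:E)%E.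
Proof.
move=> mf f0 ab bc.
have mE D : measurable_fun D (EFin \o f).
  by apply/measurable_EFinP; exact: measurable_funTS.
rewrite -[X in (_ + X)%E]integral_itv_obnd_cbnd//.
have -> : `[a, c]%classic = `[a, b] `|` `]b, c] :> set R.
  by rewrite -itv_bndbnd_setU// bnd_simp.
rewrite ge0_integral_setU//.
- exact: mE.
- by move=> x _; rewrite lee_fin.
- apply/disj_set2P; rewrite -subset0 => x [/=]; rewrite !in_itv/= => /andP[_ xb] /andP[bx _].
  by move: (lt_le_trans bx xb); rewrite ltxx.
Qed.

Lemma ge0_integral_periodic (r : R) (f : R -> R) : periodic2pi f ->
  measurable_fun setT f -> (forall x, 0 <= f x) -> - (2 * pi) <= r <= 0 ->
  (\int[mu]_(x in `[r, (r + 2 * pi)%R]) (f x)%:E =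
   \int[mu]_(x in `[0%R, (2 * pi)%R]) (f x)%:E)%E.
Proof.
move=> pf mf f0 /andP[r1 r0]; have pi0 := pi_gt0 R.
rewrite (@ge0_integral_itv_cat r 0 (r + 2 * pi)) //; last lra.
rewrite (@ge0_integral_itv_cat 0 (r + 2 * pi) (2 * pi)) //; [|lra|lra].
rewrite addeC; congr (_ + _)%E.
rewrite [RHS](ge0_integral_addl (2 * pi))// subrr addrK.
by apply: eq_integral => x _; rewrite pf.
Qed.

(** * Integrals of powers of the kernel bound, and Hoelder's inequality *)

Lemma continuous_FTC2_is_derive (F f : R -> R) (a b : R) : a < b ->
  {within `[a, b], continuous f} ->
  (forall x, x \in `[a, b] -> is_derive x 1 F (f x)) ->
  (\int[mu]_(x in `[a, b]) (f x)%:E = (F b - F a)%:E)%E.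
Proof.
move=> ab cf dF; rewrite EFinB; apply: continuous_FTC2 => //.
- have dab x : x \in `[a, b] -> derivable F x 1.
    by move=> /dF h; exact: ex_derive.
  have cF x : x \in `[a, b] -> {for x, continuous F}.
    by move=> /dab/derivable1_diffP/differentiable_continuous.
  split.
  + by move=> x /subset_itv_oo_cc; exact: dab.
  + by apply: cvg_at_right_filter; apply: cF; rewrite in_itv/= lexx ltW.
  + by apply: cvg_at_left_filter; apply: cF; rewrite in_itv/= lexx ltW.
- move=> x /subset_itv_oo_cc/dF h; rewrite derive1E; exact: derive_val.
Qed.

Lemma is_derive_powR_affine (c t a x : R) : 0 < c * x + t ->
  is_derive x 1 (fun y : R => (c * y + t) `^ a) (c * (a * (c * x + t) `^ (a - 1))).
Proof.
move=> h; rewrite mulrC.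
exact: (@is_derive1_comp R (@powR R ^~ a) (fun y => c * y + t) x _ _
  (is_derive1_powR a h) (is_derive_affine c t x)).
Qed.

(** |sin(s/2)| is at least s/4 on [0, pi] and at least (2 pi - s)/4 on [pi, 2 pi]. The integrand is
    therefore below the sum of two powers of affine functions, whose primitive is explicit and each
    of which integrates to at most 4 / (L (q - 1)). *)
Lemma integral_sin_weight_le (q L : R) : 1 < q -> 0 < L ->
  (\int[mu]_(s in `[0%R, (2 * pi)%R]) ((1 + L * `|sin (s / 2)|) `^ (- q))%:E
    <= (8 / (q - 1) / L)%:E)%E.
Proof.
move=> q1 L0; have pi0 := pi_gt0 R.
pose c := L / 4; have c0 : 0 < c by rewrite divr_gt0.
(* Chosen so that - c s + t = 1 + c (2 pi - s), the mirror image of c s + 1. *)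
pose t := 1 + c * (2 * pi).
have t1 : 1 < t by rewrite /t ltrDl mulr_gt0// mulr_gt0.
pose g1 (s : R) := (c * s + 1) `^ (- q); pose g2 (s : R) := (- c * s + t) `^ (- q).
pose k := (c * (q - 1))^-1.
have k0 : 0 < k by rewrite invr_gt0 mulr_gt0// subr_gt0.
pose F (s : R) := k * ((- c * s + t) `^ (1 - q)) + (- k) * ((c * s + 1) `^ (1 - q)).
have pos1 s : s \in `[0, 2 * pi] -> 0 < c * s + 1.
  by rewrite in_itv/= => /andP[s0 _]; rewrite ltr_wpDl// mulr_ge0// ltW.
have pos2 s : s \in `[0, 2 * pi] -> 0 < - c * s + t.
  rewrite in_itv/= => /andP[s0 s1]; rewrite /t.
  have : 0 <= c * (2 * pi - s) by rewrite mulr_ge0 ?subr_ge0// ltW.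
  by rewrite mulrBr mulNr; lra.
have dF s : s \in `[0, 2 * pi] -> is_derive s 1 F (g1 s + g2 s).
  move=> hs; have p1 := pos1 _ hs; have p2 := pos2 _ hs.
  have h1 := is_derive_scale (- k) (is_derive_powR_affine (1 - q) p1).
  have h2 := is_derive_scale k (is_derive_powR_affine (1 - q) p2).
  have -> : g1 s + g2 s = k * (- c * ((1 - q) * (- c * s + t) `^ (1 - q - 1))) +
      (- k) * (c * ((1 - q) * (c * s + 1) `^ (1 - q - 1))).
    have E : 1 - q - 1 = - q by ring.
    rewrite E -/(g1 s) -/(g2 s).
    have kc : k * (c * (q - 1)) = 1 by rewrite mulVf// gt_eqF// mulr_gt0// subr_gt0.
    transitivity (k * (c * (q - 1)) * (g1 s + g2 s)); first by rewrite kc mul1r.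
    ring.
  exact: is_deriveD h2 h1.
have cg : {within `[0, 2 * pi], continuous (fun s => g1 s + g2 s)}.
  apply: continuous_in_subspaceT => s; rewrite inE/= => hs.
  apply: cvgD.
  - have : derivable g1 s 1.
      by apply: ex_derive; exact: (is_derive_powR_affine (- q) (pos1 s hs)).
    by move=> /derivable1_diffP/differentiable_continuous.
  - have : derivable g2 s 1.
      by apply: ex_derive; exact: (is_derive_powR_affine (- q) (pos2 s hs)).
    by move=> /derivable1_diffP/differentiable_continuous.
have m1 a b : measurable_fun setT (fun s : R => (a * s + b) `^ (- q)).
  apply: measurable_fun_powR.
  by apply: measurable_funD => //; exact: measurable_funM.
apply: (@le_trans _ _ (\int[mu]_(s in `[0%R, (2 * pi)%R]) (g1 s + g2 s)%:E)%E).
  apply: ge0_le_integral => //.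
  - by move=> s _; rewrite lee_fin powR_ge0.
  - apply/measurable_EFinP; apply: measurable_funTS.
    apply: measurable_fun_powR.
    apply: measurable_funD => //; apply: measurable_funM => //.
    by apply: continuous_measurable_fun; exact: continuous_sin_half.
  - apply/measurable_EFinP; apply: measurable_funTS.
    by apply: measurable_funD; exact: m1.
  - move=> s /= hs; rewrite lee_fin.
    have p1 := pos1 _ hs; have p2 := pos2 _ hs.
    move: hs; rewrite in_itv/= => /andP[s0 s2].
    have le_pow x y : 0 < x -> x <= y -> y `^ (- q) <= x `^ (- q).
      move=> x0 xy; have y0 := lt_le_trans x0 xy.
      rewrite !powRN lef_pV2 ?posrE ?powR_gt0//.
      by rewrite ge0_ler_powR ?nnegrE//; lra.
    have [spi|spi] := leP s pi.
      rewrite -[leLHS]addr0 lerD ?powR_ge0//; apply: le_pow => //.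
      rewrite addrC lerD2l /c mulrAC -mulrA ler_pM2l//.
      have := @sin_ge_half R (s / 2) ltac:(apply/andP; split; lra).
      by move=> h; apply: (le_trans _ (ler_norm _)); lra.
    rewrite -[leLHS]add0r lerD ?powR_ge0//; apply: le_pow => //.
    have -> : - c * s + t = 1 + L * ((2 * pi - s) / 4) by rewrite /t /c; field.
    rewrite lerD2l ler_pM2l//.
    have := @sin_ge_half R (pi - s / 2) ltac:(apply/andP; split; lra).
    have -> : sin (pi - s / 2) = sin (s / 2).
      by rewrite addrC sinDpi sinN opprK.
    by move=> h; apply: (le_trans _ (ler_norm _)); lra.
rewrite (continuous_FTC2_is_derive _ cg dF)//; last by rewrite mulr_gt0.
rewrite lee_fin /F mulr0 !add0r mulNr -/t mulNr.
have -> : - (c * (2 * pi)) + t = 1 by rewrite /t; ring.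
have -> : c * (2 * pi) + 1 = t by rewrite /t addrC.
rewrite powR1 !mulr1 mulr0 add0r powR1.
have : 0 <= k * t `^ (1 - q) by rewrite mulr_ge0 ?powR_ge0// ltW.
have -> : 8 / (q - 1) / L = 2 * k.
  by rewrite /k /c; field; rewrite !gt_eqF// subr_gt0.
lra.
Qed.

Lemma powR_kernel_le (q L A s K : R) : 0 < q -> 0 < L ->
  `|K| * (1 + L * `|sin (s / 2)|) <= A ->
  `|K| `^ q <= A `^ q * (1 + L * `|sin (s / 2)|) `^ (- q).
Proof.
move=> q0 L0 h; set w := 1 + _ in h *.
have w0 : 0 < w by rewrite /w ltr_pwDl// mulr_ge0// ltW.
have A0 : 0 <= A by apply: le_trans h; rewrite mulr_ge0// ltW.
rewrite powRN -ler_pdivrMr ?invr_gt0 ?powR_gt0// invrK -powRM//; last exact: ltW.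
by rewrite ge0_ler_powR// ?nnegrE// ?mulr_ge0//; exact: ltW.
Qed.

Lemma measurable_sin_weight (q L x : R) :
  measurable_fun setT (fun s : R => (1 + L * `|sin ((s - x) / 2)|) `^ (- q)).
Proof.
apply: measurable_fun_powR.
apply: measurable_funD => //; apply: measurable_funM => //.
apply: (measurableT_comp (f := fun s : R => `|sin (s / 2)|) (g := addl (- x))).
  by apply: continuous_measurable_fun; exact: continuous_sin_half.
exact: measurable_addl.
Qed.

Lemma intp_kernel_le (q L A : R) (K : R -> R) : 1 < q -> 0 < L ->
  measurable_fun setT K ->
  (forall s, `|K s| * (1 + L * `|sin (s / 2)|) <= A) ->
  (intp q K <= (A `^ q * (8 / (q - 1) / L))%:E)%E.
Proof.
move=> q1 L0 mK hK; have q0 : 0 < q by lra.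
have mw : measurable_fun setT (fun s : R => (1 + L * `|sin (s / 2)|) `^ (- q)).
  by have := measurable_sin_weight q L 0; under eq_fun do rewrite subr0.
apply: (@le_trans _ _ (\int[mu]_(s in `[0%R, (2 * pi)%R])
    (A `^ q * (1 + L * `|sin (s / 2)|) `^ (- q))%:E)%E).
  apply: ge0_le_integral => //.
  - apply/measurable_EFinP; apply: measurable_funTS.
    apply: measurable_fun_powR.
    exact: measurableT_comp.
  - apply/measurable_EFinP; apply: measurable_funTS.
    exact: measurable_funM.
  - by move=> s _; rewrite lee_fin powR_kernel_le.
under eq_integral do rewrite EFinM.
rewrite ge0_integralZl//.
- by rewrite EFinM lee_wpmul2l ?lee_fin ?powR_ge0//; exact: integral_sin_weight_le.
- by apply/measurable_EFinP; exact: measurable_funTS.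
- by move=> s _; rewrite lee_fin powR_ge0.
- by rewrite lee_fin powR_ge0.
Qed.

(** The pointwise bound is applied before translating, so that the periodicity used to come back to
    [0, 2 pi] is that of the weight alone. *)
Lemma conv_kernel_le (q L A x : R) (K : R -> R) : 1 < q -> 0 < L ->
  - pi <= x <= pi -> measurable_fun setT K ->
  (forall s, `|K s| * (1 + L * `|sin (s / 2)|) <= A) ->
  (\int[mu]_(t in `[(- pi)%R, pi]) (`|K (x - t)| `^ q)%:E
    <= (A `^ q * (8 / (q - 1) / L))%:E)%E.
Proof.
move=> q1 L0 /andP[x1 x2] mK hK; have q0 : 0 < q by lra.
have pi0 := pi_gt0 R.
have mw := measurable_sin_weight q L x.
have mK' : measurable_fun setT (fun t : R => K (x - t)).
  by apply: measurableT_comp => //; exact: measurable_funB.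
apply: (@le_trans _ _ (\int[mu]_(s in `[(- pi)%R, pi])
    (A `^ q * (1 + L * `|sin ((s - x) / 2)|) `^ (- q))%:E)%E).
  apply: ge0_le_integral => //.
  - apply/measurable_EFinP; apply: measurable_funTS.
    apply: measurable_fun_powR.
    exact: measurableT_comp.
  - apply/measurable_EFinP; apply: measurable_funTS.
    exact: measurable_funM.
  - move=> s _; rewrite lee_fin.
    have E : `|sin ((s - x) / 2)| = `|sin ((x - s) / 2)|.
      by rewrite -normrN -sinN -mulNr opprB.
    by rewrite E; exact: powR_kernel_le.
under eq_integral do rewrite EFinM.
rewrite ge0_integralZl//; last first.
- by rewrite lee_fin powR_ge0.
- by move=> s _; rewrite lee_fin powR_ge0.
- by apply/measurable_EFinP; exact: measurable_funTS.
rewrite EFinM lee_wpmul2l ?lee_fin ?powR_ge0//.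
rewrite (ge0_integral_addl x)//; last by move=> ?; exact: powR_ge0.
under eq_integral do rewrite addrK.
have -> : pi - x = (- pi - x) + 2 * pi by ring.
rewrite (@ge0_integral_periodic _ (fun s => (1 + L * `|sin (s / 2)|) `^ (- q))).
- exact: integral_sin_weight_le.
- move=> s; have -> : (s + 2 * pi) / 2 = s / 2 + pi by field.
  by rewrite sinDpi normrN.
- by have := measurable_sin_weight q L 0; under eq_fun do rewrite subr0.
- by move=> s; exact: powR_ge0.
- by apply/andP; split; lra.
Qed.

(** Young's inequality for |f| and |g| / M, multiplied by M, integrates to M (1/p + 1/q) = M; the
    same estimate shows that f g is integrable. *)
Lemma young_Rintegral (p q M : R) (D : set R) (f g : R -> R) :
  0 < p -> 0 < q -> p^-1 + q^-1 = 1 -> 0 < M -> measurable D ->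
  measurable_fun setT f -> measurable_fun setT g ->
  (\int[mu]_(x in D) (`|f x| `^ p)%:E <= 1)%E ->
  (\int[mu]_(x in D) (`|g x| `^ q)%:E <= (M `^ q)%:E)%E ->
  `|\int[mu]_(x in D) (f x * g x)| <= M.
Proof.
move=> p0 q0 pq M0 mD mf mg hf hg.
have mpow r h : measurable_fun setT h -> measurable_fun D (EFin \o (fun x => `|h x : R| `^ r)).
  move=> mh; apply/measurable_EFinP; apply: measurable_funTS.
  by apply: measurable_fun_powR; exact: measurableT_comp.
have mfg : measurable_fun D (EFin \o (fun x => f x * g x)).
  by apply/measurable_EFinP; apply: measurable_funTS; exact: measurable_funM.
have Mq0 : 0 < M `^ q by rewrite powR_gt0.
have le_int : (\int[mu]_(x in D) `|(f x * g x)%:E| <= M%:E)%E.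
  apply: (@le_trans _ _ (\int[mu]_(x in D)
     ((M / p)%:E * (`|f x| `^ p)%:E + (M / q / M `^ q)%:E * (`|g x| `^ q)%:E))%E).
    apply: ge0_le_integral => //.
    - exact: measurableT_comp.
    - apply: emeasurable_funD; apply: emeasurable_funM => //; exact: mpow.
    - move=> x _; rewrite -!EFinM -EFinD lee_fin normrM.
      have := @conjugate_powR R `|f x| (`|g x| / M) p q (normr_ge0 _)
        (divr_ge0 (normr_ge0 _) (ltW M0)) p0 q0 pq.
      rewrite powRM ?invr_ge0//; last exact: ltW.
      have -> : M^-1 `^ q = (M `^ q)^-1.
        by rewrite -powR_inv1 ?ltW// -powRrM mulN1r powRN.
      rewrite mulrA ler_pdivrMr// => h; apply: (le_trans h).
      by rewrite le_eqVlt; apply/orP; left; apply/eqP; field; rewrite !gt_eqF.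
  have mp : measurable_fun D (fun x => (`|f x| `^ p)%:E) by exact: mpow.
  have mq : measurable_fun D (fun x => (`|g x| `^ q)%:E) by exact: mpow.
  have c1 : (0 <= (M / p)%:E)%E by rewrite lee_fin divr_ge0// ltW.
  have c2 : (0 <= (M / q / M `^ q)%:E)%E by rewrite lee_fin !divr_ge0// ltW.
  have pow0 r y : (0 <= (y `^ r : R)%:E)%E by rewrite lee_fin powR_ge0.
  rewrite ge0_integralD//; first last.
  all: try by apply: emeasurable_funM.
  all: try by move=> x _; rewrite mule_ge0.
  rewrite !ge0_integralZl//.
  apply: (@le_trans _ _ ((M / p)%:E * 1 + (M / q / M `^ q)%:E * (M `^ q)%:E)%E).
    by apply: leeD; apply: lee_wpmul2l => //; rewrite lee_fin !divr_ge0// ltW.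
  rewrite mule1 -EFinM -EFinD lee_fin divfK ?gt_eqF//.
  by rewrite -mulrDr pq mulr1.
have ifg : mu.-integrable D (EFin \o (fun x => f x * g x)).
  by apply/integrableP; split => //; exact: (le_lt_trans le_int (ltry _)).
rewrite -lee_fin EFin_normr_Rintegral//.
by apply: le_trans le_int; exact: le_abse_integral.
Qed.

Lemma integrable_periodic (f : R -> R) : inL1 f ->
  mu.-integrable `[- pi, pi] (EFin \o f).
Proof.
move=> [pf mf /integrableP[_ fi]]; have pi0 := pi_gt0 R.
apply/integrableP; split.
  by apply/measurable_EFinP; exact: measurable_funTS.
have {2}-> : pi = - pi + 2 * pi :> R by ring.
rewrite (@ge0_integral_periodic (- pi) (fun x => `|f x|))//.
- by move=> x; rewrite pf.
- exact: measurableT_comp.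
- by apply/andP; split; lra.
Qed.

Lemma intp_periodic (p : R) (f : R -> R) : periodic2pi f -> measurable_fun setT f ->
  (\int[mu]_(x in `[(- pi)%R, pi]) (`|f x| `^ p)%:E = intp p f)%E.
Proof.
move=> pf mf; have pi0 := pi_gt0 R; rewrite /intp.
have {2}-> : pi = - pi + 2 * pi :> R by ring.
rewrite (@ge0_integral_periodic (- pi) (fun x => `|f x| `^ p))//.
- by move=> x; rewrite pf.
- by apply: measurable_fun_powR; exact: measurableT_comp.
- by apply/andP; split; lra.
Qed.

End integrals.

(** * Functions with bounded Fejer means *)

Lemma derive_le_lipschitz (R : realType) (G : R -> R) (x d M : R) :
  is_derive x 1 G d ->
  (\forall h \near 0, `|G (h + x) - G x| <= M * `|h|) -> `|d| <= M.
Proof.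
move=> [dG dE] lipG.
have : h^-1 *: (G (h + x) - G x) @[h --> 0^'] --> d.
  rewrite -dE /derive; apply: cvg_trans dG; apply: near_eq_cvg.
  by near=> h; rewrite /= /GRing.scale/= mulr1.
move=> /cvg_norm cG.
rewrite -(cvg_lim _ cG)//; apply: limr_le; first by apply/cvg_ex; exists `|d|.
have : \forall h \near 0^', h != 0 /\ `|G (h + x) - G x| <= M * `|h|.
  near=> h; split; first by near: h; exact: nbhs_dnbhs_neq.
  by near: h; exact: nbhs_dnbhs.
apply: filterS => h [h0 hG].
rewrite normrM normfV mulrC ler_pdivrMr// normr_gt0//.
Unshelve. all: by end_near. Qed.

Section fejer_ae.
Variable R : realType.
Local Notation mu := (@lebesgue_measure R).
Local Notation D := (`[- pi, pi]%classic : set (measurableTypeR R)).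

Lemma integrableM_bounded (f g : R -> R) (C : R) :
  mu.-integrable D (EFin \o f) -> measurable_fun setT g -> (forall t, D t -> `|g t| <= C) ->
  mu.-integrable D (EFin \o (fun t => f t * g t)).
Proof.
move=> fi mg gC; have mD : measurable D by [].
have /integrableP[/measurable_EFinP mf _] := fi.
have pi0 := pi_gt0 R.
have C0 : 0 <= C.
  by apply: le_trans (gC 0 _); rewrite ?normr_ge0//= in_itv/=; apply/andP; split; lra.
apply: (@le_integrable _ _ _ _ _ mD _ (fun t => (C%:E * (f t)%:E)%E)).
- by apply/measurable_EFinP; apply: measurable_funM => //; exact: measurable_funTS.
- move=> t Dt /=; rewrite lee_fin !normrM mulrC (ger0_norm C0).
  by rewrite ler_wpM2r// gC.
- exact: integrableZl.
Qed.

Lemma Rintegral_sum (I : Type) (r : seq I) (h : I -> R -> R) :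
  (forall i, mu.-integrable D (EFin \o h i)) ->
  \int[mu]_(t in D) (\sum_(i <- r) h i t) = \sum_(i <- r) \int[mu]_(t in D) h i t.
Proof.
move=> hi; have mD : measurable D by [].
elim: r => [|i r IH].
  rewrite big_nil; under eq_Rintegral do rewrite big_nil.
  by rewrite Rintegral_cst// mul0r.
rewrite big_cons -IH -RintegralD//; first by apply: eq_Rintegral => t _; rewrite big_cons.
rewrite (_ : _ \o _ = fun t => (\sum_(i <- r) (EFin \o h i) t)%E).
  by apply: integrable_sum => // j _; exact: hi.
by apply/funext => t /=; rewrite sumEFin.
Qed.

Lemma measurable_cos_affine (c t : R) : measurable_fun setT (fun x : R => cos (c * x + t)).
Proof.
apply: continuous_measurable_fun => x.
have /derivable1_diffP/differentiable_continuous : derivable (fun x : R => cos (c * x + t)) x 1.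
  by apply: ex_derive; exact: is_derive_cos_affine.
exact.
Qed.

Lemma measurable_cosM (c : R) : measurable_fun setT (fun x : R => cos (c * x)).
Proof. by have := measurable_cos_affine c 0; under eq_fun do rewrite addr0. Qed.

Lemma measurable_sinM (c : R) : measurable_fun setT (fun x : R => sin (c * x)).
Proof.
have := measurable_cos_affine c (- (pi / 2)).
by under eq_fun do rewrite cosB cos_pihalf sin_pihalf mulr0 add0r mulr1.
Qed.

Definition cosI (f : R -> R) (k : R) := \int[mu]_(t in D) (f t * cos (k * t)).
Definition sinI (f : R -> R) (k : R) := \int[mu]_(t in D) (f t * sin (k * t)).

(* [trigI f k x] is the integral of [f t * cos (k * (x - t))] over a period. *)
Definition trigI (f : R -> R) (k x : R) := cos (k * x) * cosI f k + sin (k * x) * sinI f k.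

Lemma trigI_le (f : R -> R) (k x : R) : `|trigI f k x| <= `|cosI f k| + `|sinI f k|.
Proof.
apply: (le_trans (ler_normD _ _)).
by rewrite !normrM lerD// ler_piMl// ?cos_max ?sin_max.
Qed.

(** The weights are left free: w = 2 gives the partial sum [S] below, and w k = 2 (1 - k/(N+1)) the
    Fejer mean [dP], both multiplied by 2 pi. *)
Lemma is_derive_trigI_prim (f : R -> R) (r : seq nat) (w : nat -> R) (x : R) :
  (forall k, k \in r -> (0 < k)%N) ->
  is_derive x 1 (fun y => y * cosI f 0 + \sum_(k <- r)
      w k / k%:R * (sin (k%:R * y) * cosI f k%:R - cos (k%:R * y) * sinI f k%:R))
    (cosI f 0 + \sum_(k <- r) w k * trigI f k%:R x).
Proof.
move=> r0; apply: is_deriveD.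
  have := is_derive_affine (cosI f 0) 0 x.
  by under eq_fun do rewrite addr0 mulrC.
rewrite (eq_big_seq (fun k => w k / k%:R * (k%:R * cos (k%:R * x) * cosI f k%:R -
   (- k%:R * sin (k%:R * x)) * sinI f k%:R))) => [|k /r0 k0]; last first.
  by rewrite /trigI; field; rewrite pnatr_eq0 -lt0n.
apply: is_derive_sumr => k; apply: is_derive_scale.
have dm c (u : R -> R) du : is_derive x 1 u du -> is_derive x 1 (fun y => u y * c) (du * c).
  by move=> /(is_derive_scale c); rewrite mulrC; under eq_fun do rewrite mulrC.
apply: is_deriveB; apply: dm.
- by have := is_derive_sin_affine k%:R 0 x; under eq_fun do rewrite addr0; rewrite addr0.
- by have := is_derive_cos_affine k%:R 0 x; under eq_fun do rewrite addr0; rewrite addr0.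
Qed.

Section criterion.
Variables (f : R -> R) (n : nat) (M : R).
Hypothesis f_int : mu.-integrable D (EFin \o f).
Hypothesis f_meas : measurable_fun setT f.
Hypothesis fejer_tail : forall N x, - pi <= x <= pi ->
  `|\sum_(n <= k < N.+1) 2 * (1 - k%:R / N.+1%:R) * trigI f k%:R x| <= M.

Let S x := cosI f 0 + \sum_(1 <= k < n) 2 * trigI f k%:R x.
Let Q x := x * cosI f 0 + \sum_(1 <= k < n) 2 / k%:R *
  (sin (k%:R * x) * cosI f k%:R - cos (k%:R * x) * sinI f k%:R).
Let P N x := x * cosI f 0 + \sum_(1 <= k < N.+1) 2 * (1 - k%:R / N.+1%:R) / k%:R *
  (sin (k%:R * x) * cosI f k%:R - cos (k%:R * x) * sinI f k%:R).
Let dP N x := cosI f 0 + \sum_(1 <= k < N.+1) 2 * (1 - k%:R / N.+1%:R) * trigI f k%:R x.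

Let pos_iota m k : k \in index_iota 1 m -> (0 < k)%N.
Proof. by rewrite mem_index_iota => /andP[]. Qed.

Let dPE N (x : R) : is_derive x 1 (P N) (dP N x).
Proof.
exact: (is_derive_trigI_prim f (fun k => 2 * (1 - k%:R / N.+1%:R)) x (@pos_iota N.+1)).
Qed.

Let dQE (x : R) : is_derive x 1 Q (S x).
Proof. exact: (is_derive_trigI_prim f (fun k => 2) x (@pos_iota n)). Qed.

Let C := \sum_(1 <= k < n) 2 * k%:R * (`|cosI f k%:R| + `|sinI f k%:R|).

(** Below n the Fejer weights differ from those of the partial sum by O(k/(N+1)). The resulting [C]
    depends on f and n, which is harmless since C/(N+1) vanishes in the limit. *)
Let dPS N x : (0 < n)%N -> (n <= N)%N -> - pi <= x <= pi ->
  `|dP N x - S x| <= M + C / N.+1%:R.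
Proof.
move=> n0 nN xpi.
have -> : dP N x - S x =
    \sum_(n <= k < N.+1) 2 * (1 - k%:R / N.+1%:R) * trigI f k%:R x -
    \sum_(1 <= k < n) 2 * (k%:R / N.+1%:R) * trigI f k%:R x.
  rewrite /dP /S (big_cat_nat (n := n))//=; last by rewrite ltnW.
  set T := \sum_(n <= k < N.+1) _.
  have -> : \sum_(1 <= i < n) 2 * (1 - i%:R / N.+1%:R) * trigI f i%:R x =
    \sum_(1 <= k < n) 2 * trigI f k%:R x - \sum_(1 <= k < n) 2 * (k%:R / N.+1%:R) * trigI f k%:R x.
    by rewrite -sumrB; apply: eq_bigr => k _; ring.
  ring.
apply: (le_trans (ler_normB _ _)); rewrite lerD//; first exact: fejer_tail.
apply: (le_trans (ler_norm_sum _ _ _)); rewrite mulr_suml; apply: ler_sum => k _.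
rewrite normrM ger0_norm; last by rewrite mulr_ge0// divr_ge0.
have -> : 2 * k%:R * (`|cosI f k%:R| + `|sinI f k%:R|) / N.+1%:R =
  2 * (k%:R / N.+1%:R) * (`|cosI f k%:R| + `|sinI f k%:R|) by ring.
by rewrite ler_wpM2l ?trigI_le// mulr_ge0// divr_ge0.
Qed.

Let PQ_le N a b : (0 < n)%N -> (n <= N)%N -> - pi < a -> a < b -> b < pi ->
  `|(P N b - P N a) - (Q b - Q a)| <= (M + C / N.+1%:R) * (b - a).
Proof.
move=> n0 nN pa ab bp.
have d (x : R) : is_derive x 1 (fun y => P N y - Q y) (dP N x - S x).
  exact: (is_deriveB (dPE N x) (dQE x)).
have [|c] := @MVT R (fun y => P N y - Q y) (fun x => dP N x - S x) a b ab.
  by apply: derivable_within_continuous => x _; apply: ex_derive; exact: d.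
rewrite in_itv/= => /andP[ac cb] E.
have -> : P N b - P N a - (Q b - Q a) = P N b - Q b - (P N a - Q a) by ring.
rewrite E normrM (gtr0_norm (_ : 0 < b - a)) ?subr_gt0// ler_pM2r ?subr_gt0//.
by apply: dPS => //; apply/andP; split; lra.
Qed.

(** Both sides are finite trigonometric sums, so the integral is exchanged with the primitive term
    by term. *)
Let P_integral N a b :
  P N b - P N a = \int[mu]_(t in D) (f t * (fejer_prim N (b - t) - fejer_prim N (a - t))).
Proof.
have mD : measurable D by [].
pose c k : R := 2 * (1 - k%:R / N.+1%:R) / k%:R.
pose h k t := c k * (sin (k%:R * b) - sin (k%:R * a)) * (f t * cos (k%:R * t)) -
              c k * (cos (k%:R * b) - cos (k%:R * a)) * (f t * sin (k%:R * t)).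
have ic k : mu.-integrable D (EFin \o (fun t => f t * cos (k * t))).
  apply: (@integrableM_bounded _ _ 1) => //; first exact: measurable_cosM.
  by move=> t _; exact: cos_max.
have isn k : mu.-integrable D (EFin \o (fun t => f t * sin (k * t))).
  apply: (@integrableM_bounded _ _ 1) => //; first exact: measurable_sinM.
  by move=> t _; exact: sin_max.
have iZ z g : mu.-integrable D (EFin \o g) -> mu.-integrable D (EFin \o (fun t => z * g t)).
  move=> gi; have := integrableZl mD z gi.
  by apply: eq_integrable => // t _; rewrite /= EFinM.
have hi k : mu.-integrable D (EFin \o h k).
  have := integrableB mD (iZ (c k * (sin (k%:R * b) - sin (k%:R * a))) _ (ic k%:R))
    (iZ (c k * (cos (k%:R * b) - cos (k%:R * a))) _ (isn k%:R)).
  by apply: eq_integrable => // t _; rewrite /= EFinB.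
(* The factor cos (0 * t) = 1 makes the integral of the first term literally [cosI f 0]. *)
transitivity (\int[mu]_(t in D) ((b - a) * (f t * cos (0 * t)) + \sum_(1 <= k < N.+1) h k t)).
  rewrite RintegralD//; [|exact: iZ|]; last first.
    rewrite (_ : _ \o _ = fun t => (\sum_(1 <= k < N.+1) (EFin \o h k) t)%E).
      by apply: integrable_sum => // j _; exact: hi.
    by apply/funext => t /=; rewrite sumEFin.
  rewrite Rintegral_sum// RintegralZl//.
  rewrite /P opprD addrACA -mulrBl -sumrB; congr (_ + _).
  apply: eq_bigr => k _; rewrite /h RintegralB//; [|exact: iZ|exact: iZ].
  by rewrite !RintegralZl// -/(cosI f k%:R) -/(sinI f k%:R) /c; ring.
apply: eq_Rintegral => t _; rewrite mul0r cos0 mulr1 /fejer_prim opprD addrACA -sumrB.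
rewrite mulrDr; congr (_ + _); first by ring.
rewrite mulr_sumr; apply: eq_bigr => k _; rewrite /h -/(c k) !mulrBr !sinB.
ring.
Qed.

(** The difference of primitives tends to pi - (- pi) = 2 pi for t in ]a, b[ and to 0 for t outside
    [a, b]; the two end points are negligible. As a and b are interior, b - t and a - t stay in ]-2
    pi, 2 pi[, where the limits are known, and 4 pi |f| dominates. *)
Let P_cvg a b : - pi < a -> a < b -> b < pi ->
  P N b - P N a @[N --> \oo] --> 2 * pi * \int[mu]_(t in `[a, b]) f t.
Proof.
move=> pa ab bp; have mD : measurable D by []; have pi0 := pi_gt0 R.
pose u N (t : R) := (f t * (fejer_prim N (b - t) - fejer_prim N (a - t)))%:E.
pose v (t : R) := (2 * pi * (f \_ `[a, b]) t)%:E.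
have mH N (c : R) : measurable_fun setT (fun t : R => fejer_prim N (c - t)).
  apply: (measurableT_comp (f := fejer_prim N)); last exact: measurable_funB.
  apply: continuous_measurable_fun => x.
  have /derivable1_diffP/differentiable_continuous : derivable (fejer_prim N) x 1.
    by apply: ex_derive; exact: is_derive_fejer_prim.
  exact.
have cvgN y : - (2 * pi) < y < 0 -> fejer_prim N y @[N --> \oo] --> (- pi : R).
  move=> /andP[y1 y2].
  have -> : (fun N => fejer_prim N y) = (fun N => - fejer_prim N (- y)).
    by apply/funext => N; rewrite fejer_primN opprK.
  by apply: cvgN; apply: fejer_prim_cvg; apply/andP; split; lra.
have [] := @dominated_convergence _ _ _ mu D mD u v (fun t => ((4 * pi)%:E * `|(f t)%:E|)%E).
- move=> N; apply/measurable_EFinP; apply: measurable_funTS.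
  by apply: measurable_funM => //; apply: measurable_funB; exact: mH.
- apply/measurable_EFinP; apply: measurable_funTS; apply: measurable_funM => //.
  by apply/(measurable_restrictT _ _).1 => //; exact: measurable_funTS.
- have : mu.-negligible ([set a] `|` [set b]).
    by apply: negligibleU; apply/negligibleP => //; exact: lebesgue_measure_set1.
  apply: negligibleS => t /= /not_implyP[]; rewrite in_itv/= => /andP[tp1 tp2] h.
  apply: contrapT => /not_orP[/eqP ta /eqP tb]; apply: h.
  rewrite /u /v; apply: cvg_EFin; first by near=> N.
  rewrite /comp/= mulrC patchE.
  have [tab|] := boolP (t \in _).
    move: tab; rewrite inE/= in_itv/= => /andP[at' tb'].
    have at2 : a < t by rewrite lt_neqAle eq_sym ta.
    have tb2 : t < b by rewrite lt_neqAle tb.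
    apply: cvgM; first exact: cvg_cst.
    rewrite (_ : 2 * pi = pi - (- pi)); last by ring.
    apply: cvgB; first by apply: fejer_prim_cvg; apply/andP; split; lra.
    by apply: cvgN; apply/andP; split; lra.
  rewrite notin_setE/= in_itv/= => /negP; rewrite negb_and -!ltNge => tab.
  rewrite mul0r -[X in _ --> X](mulr0 (f t)).
  apply: cvgM; first exact: cvg_cst.
  case/orP: tab => tab.
    rewrite -[X in _ --> X](subrr pi).
    by apply: cvgB; apply: fejer_prim_cvg; apply/andP; split; lra.
  rewrite -[X in _ --> X](subrr (- pi)).
  by apply: cvgB; apply: cvgN; apply/andP; split; lra.
- by apply: integrableZl => //; exact: integrable_abse.
- apply: aeW => t N; rewrite /= in_itv/= => /andP[t1 t2].
  rewrite -EFinM lee_fin normrM mulrC ler_wpM2r//.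
  have -> : 4 * pi = 2 * pi + 2 * pi :> R by ring.
  apply: (le_trans (ler_normB _ _)).
  by rewrite lerD// fejer_prim_le2pi// ler_norml; apply/andP; split; lra.
move=> vi _ h.
have vE : (\int[mu]_(t in D) v t)%E = (2 * pi * \int[mu]_(t in `[a, b]) f t)%:E.
  have subab : `[a, b] `<=` D.
    by move=> t /=; rewrite !in_itv/= => /andP[ta tb]; apply/andP; split; lra.
  rewrite -(fineK (integrable_fin_num mD vi)); congr EFin.
  rewrite -[LHS]/(\int[mu]_(t in D) (2 * pi * (f \_ `[a, b]) t)) RintegralZl//.
    by rewrite -Rintegral_mkcondr setIidr.
  rewrite -restrict_EFin; apply/integrable_restrict => //; rewrite setIidr//.
  exact: (integrableS mD).
rewrite vE in h.
have -> : (fun N => P N b - P N a) = fine \o (fun N => (\int[mu]_(x in D) u N x)%E).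
  by apply/funext => N; rewrite P_integral.
exact: fine_cvg h.
Unshelve. all: by end_near. Qed.

Lemma integral_sub_le a b : (0 < n)%N -> - pi < a -> a < b -> b < pi ->
  `|2 * pi * \int[mu]_(t in `[a, b]) f t - (Q b - Q a)| <= M * (b - a).
Proof.
move=> n0 pa ab bp.
have c1 : `|P N b - P N a - (Q b - Q a)| @[N --> \oo] -->
    `|2 * pi * \int[mu]_(t in `[a, b]) f t - (Q b - Q a)|.
  by apply: cvg_norm; apply: cvgB; [exact: P_cvg|exact: cvg_cst].
have c2 : (M + C / N.+1%:R) * (b - a) @[N --> \oo] --> M * (b - a).
  apply: cvgM; last exact: cvg_cst.
  rewrite -[X in _ --> X](addr0 M); apply: cvgD; first exact: cvg_cst.
  exact: cvg_inv_nat.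
rewrite -(cvg_lim _ c1)// -[leRHS](cvg_lim _ c2)//.
apply: ler_lim; [by apply/cvg_ex; eexists; exact: c1|by apply/cvg_ex; eexists; exact: c2|].
by exists n => // N /= nN; exact: PQ_le.
Qed.

(* [P N] is a primitive of the N-th Fejer mean of f and [Q] one of the n-th
   partial sum of its Fourier series (up to the factor 2 pi). Since [P N b - P N a] tends to
   2 pi times the integral of f over [a, b], the primitive of f minus its
   partial sum is Lipschitz, and the Lebesgue differentiation theorem applies. *)
Theorem fejer_ae_bound : (0 < n)%N ->
  {ae mu, forall x, x \in `]- pi, pi[ -> `|2 * pi * f x - S x| <= M}.
Proof.
move=> n0; have mD : measurable D by []; have pi0 := pi_gt0 R.
(* Cut off outside one period, f is integrable on the whole line and has a primitive from -oo; its
   increments inside ]-pi, pi[ are those of f. *)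
pose fD := f \_ D.
have fDi : mu.-integrable setT (EFin \o fD).
  by rewrite /fD -restrict_EFin; apply/integrable_restrict => //; rewrite setTI.
have mfD : measurable_fun setT fD by have /integrableP[/measurable_EFinP] := fDi.
have ifD A : measurable A -> mu.-integrable A (EFin \o fD).
  by move=> mA; apply: (integrableS measurableT).
have lfD : locally_integrable [set: R] fD.
  exact: integrable_locally.
have := FTC1Ny (fun y => ifD _ (measurable_itv `]-oo, y])) lfD.
apply: filterS; first exact: (ae_filter_ringOfSetsType mu).
move=> x [dF F'] xpi; move: (xpi); rewrite in_itv/= => /andP[x1 x2].
set F := fun x => _ in dF F'.
have fDx : fD x = f x by rewrite /fD patchE mem_set//= in_itv/= !ltW.
rewrite fDx in F'.
have dFx : is_derive x 1 F (f x) by rewrite -F' derive1E; apply: DeriveDef.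
have dG : is_derive x 1 (fun y => 2 * pi * F y - Q y) (2 * pi * f x - S x).
  exact: (is_deriveB (is_derive_scale (2 * pi) dFx) (dQE x)).
have FE a b : - pi < a -> a < b -> b < pi -> F b - F a = \int[mu]_(t in `[a, b]) f t.
  move=> pa ab bp; rewrite /F Rintegral_itvB//.
  - rewrite Rintegral_itv_obnd_cbnd; last exact: ifD.
    apply: eq_Rintegral => t; rewrite inE/= in_itv/= => /andP[ta tb].
    by rewrite /fD patchE mem_set//= in_itv/=; apply/andP; split; lra.
  - exact: ifD.
  - by rewrite bnd_simp ltW.
have key a b : - pi < a -> a < b -> b < pi ->
    `|2 * pi * F b - Q b - (2 * pi * F a - Q a)| <= M * (b - a).
  move=> pa ab bp.
  have -> : 2 * pi * F b - Q b - (2 * pi * F a - Q a) = 2 * pi * (F b - F a) - (Q b - Q a) by ring.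
  by rewrite FE//; exact: integral_sub_le.
apply: (derive_le_lipschitz dG).
have e0 : 0 < Num.min (x + pi) (pi - x) by rewrite lt_min; apply/andP; split; lra.
exists (Num.min (x + pi) (pi - x)) => //= h.
rewrite /= sub0r normrN lt_min !ltr_norml => /andP[/andP[h1 h2] /andP[h3 h4]].
have [h0|h0|->] := ltgtP h 0.
- rewrite distrC (ltr0_norm h0) (_ : - h = x - (h + x)); last by ring.
  by apply: key; lra.
- rewrite (gtr0_norm h0) (_ : M * h = M * ((h + x) - x)); last by ring.
  by apply: key; lra.
- by rewrite add0r subrr normr0 mulr0.
Qed.

End criterion.

(** [supnorm] looks at [0, 2 pi], whereas [fejer_ae_bound] holds on ]-pi, pi[. The new exceptional
    set consists of the old one, its translate by 2 pi, and the point pi, which no translate of the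
    open interval covers. *)
Lemma ae_periodic (T : R -> Prop) : (forall x, T (x + 2 * pi) <-> T x) ->
  {ae mu, forall x, x \in `]- pi, pi[ -> T x} ->
  {ae mu, forall x, x \in `[0, 2 * pi] -> T x}.
Proof.
move=> pT [A [mA A0 sA]]; have pi0 := pi_gt0 R.
pose B := (addl (- (2 * pi)) : _ -> measurableTypeR R) @^-1` A.
have mB : measurable B.
  by rewrite -[X in measurable X]setTI; apply: (measurable_addl (- (2 * pi))).
exists (A `|` B `|` [set pi]); split.
- by apply: measurableU => //; exact: measurableU.
- apply/negligibleP; first by apply: measurableU => //; exact: measurableU.
  apply: negligibleU; last by apply/negligibleP => //; exact: lebesgue_measure_set1.
  apply: negligibleU; apply/negligibleP => //.
  by have := lebesgue_measure_addl (- (2 * pi)) mA; rewrite /pushforward A0.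
- move=> x /= /not_implyP[]; rewrite in_itv/= => /andP[x0 x2] nT.
  have [xp|xp|->] := ltgtP x pi; [left; left|left; right|by right].
  + by apply: sA => /= /(_ ltac:(rewrite in_itv/=; apply/andP; split; lra)).
  + apply: sA => /= /(_ ltac:(rewrite in_itv/= /addl; apply/andP; split; lra)) h.
    by apply: nT; rewrite -(subrK (2 * pi) x); apply/pT.
Qed.

End fejer_ae.

(** * The upper bound *)

Lemma cmod_le (R : realType) (a b : R) : cmod (a +i* b)%C <= `|a| + `|b|.
Proof.
rewrite /cmod/= -[leRHS]ger0_norm ?addr_ge0// -sqrtr_sqr ler_wsqrtr//.
rewrite -(real_normK (num_real a)) -(real_normK (num_real b)) sqrrD.
by rewrite addrAC lerDl mulrn_wge0// mulr_ge0.
Qed.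

Fixpoint symm_int (n : nat) : seq int :=
  if n is n'.+1 then n'.+1%:Z :: - n'.+1%:Z :: symm_int n' else [:: 0].

Lemma symm_int_le n k : k \in symm_int n -> (`|k| <= n)%N.
Proof.
elim: n => [|n IH]; first by rewrite inE => /eqP->.
by rewrite !inE => /or3P[/eqP->|/eqP->|/IH]; lia.
Qed.

Lemma symm_int_uniq n : uniq (symm_int n).
Proof.
elim: n => [//|n IH] /=; rewrite IH andbT inE negb_or -andbA.
apply/and3P; split; first by lia.
- by apply/negP => /symm_int_le; lia.
- by apply/negP => /symm_int_le; lia.
Qed.

Lemma size_symm_int n : size (symm_int n) = (2 * n + 1)%N.
Proof. by elim: n => //= n ->; lia. Qed.

Lemma cosD2pi_nat (R : realType) (k : nat) (y : R) :
  cos (k%:R * (y + 2 * pi)) = cos (k%:R * y).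
Proof.
have cosD2 (j : nat) (z : R) : cos (z + (2 * j)%:R * pi) = cos z.
  elim: j => [|j IH]; first by rewrite muln0 mul0r addr0.
  have -> : z + (2 * j.+1)%:R * pi = z + (2 * j)%:R * pi + pi + pi.
    by rewrite mulnS natrD; ring.
  by rewrite !cosDpi opprK.
have -> : k%:R * (y + 2 * pi) = k%:R * y + (2 * k)%:R * pi by rewrite natrM; ring.
exact: cosD2.
Qed.

Section upper.
Variable R : realType.
Local Notation mu := (@lebesgue_measure R).
Local Notation D := (`[- pi, pi]%classic : set (measurableTypeR R)).

Lemma trigI_periodic (f : R -> R) (k : nat) (x : R) :
  trigI f k%:R (x + 2 * pi) = trigI f k%:R x.
Proof. by rewrite /trigI cosD2pi_nat sinD2pi_nat. Qed.

Lemma integrableM_cos (f : R -> R) (k : R) : mu.-integrable D (EFin \o f) ->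
  mu.-integrable D (EFin \o (fun t => f t * cos (k * t))).
Proof.
move=> fi; apply: (@integrableM_bounded _ _ _ 1) => //; first exact: measurable_cosM.
by move=> t _; exact: cos_max.
Qed.

Lemma integrableM_sin (f : R -> R) (k : R) : mu.-integrable D (EFin \o f) ->
  mu.-integrable D (EFin \o (fun t => f t * sin (k * t))).
Proof.
move=> fi; apply: (@integrableM_bounded _ _ _ 1) => //; first exact: measurable_sinM.
by move=> t _; exact: sin_max.
Qed.

Lemma fourier_nat (f : R -> R) (k : nat) : fourier f k =
  ((cosI f k%:R / (2 * pi)) -i* (sinI f k%:R / (2 * pi)))%C.
Proof. by []. Qed.

Lemma fourierN_nat (f : R -> R) (k : nat) : mu.-integrable D (EFin \o f) ->
  fourier f (- k%:Z) = ((cosI f k%:R / (2 * pi)) +i* (sinI f k%:R / (2 * pi)))%C.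
Proof.
move=> fi; rewrite /fourier; congr (_ +i* _)%C.
  congr (_ / _); apply: eq_Rintegral => t _.
  by rewrite mulrNz mulNr cosN.
rewrite -mulNr; congr (_ / _).
rewrite -[LHS]mulN1r -RintegralZl//.
  by apply: eq_Rintegral => t _; rewrite mulN1r mulrNz mulNr sinN mulrN opprK.
exact: integrableM_sin.
Qed.

Lemma fourier_rem_symm (f : R -> R) (n : nat) (x : R) : mu.-integrable D (EFin \o f) ->
  \sum_(k <- symm_int n) fourier f k * expi (k%:~R * x) =
  (((cosI f 0 + \sum_(1 <= k < n.+1) 2 * trigI f k%:R x) / (2 * pi))%:C)%C.
Proof.
move=> fi; have pi0 := pi_gt0 R.
elim: n => [|n IH].
  rewrite big_seq1 big_geq// addr0 (fourier_nat f 0) /expi mul0r cos0 sin0.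
  have -> : sinI f 0 = 0.
    rewrite /sinI; under eq_Rintegral do rewrite mul0r sin0 mulr0.
    by rewrite Rintegral_cst// mul0r.
  by apply/eqP; rewrite eq_complex /=; apply/andP; split; apply/eqP; ring.
rewrite -[symm_int n.+1]/(n.+1%:Z :: - n.+1%:Z :: symm_int n) 2![in LHS]big_cons IH.
rewrite fourierN_nat// fourier_nat mulrNz mulNr /expi cosN sinN.
have -> : \sum_(1 <= k < n.+2) 2 * trigI f k%:R x =
  \sum_(1 <= k < n.+1) 2 * trigI f k%:R x + 2 * trigI f n.+1%:R x by rewrite big_nat_recr.
set T := \sum_(1 <= k < n.+1) _.
rewrite -[n.+1%:~R]/(n.+1%:R) /trigI.
set C := cos (n.+1%:R * x); set s := sin (n.+1%:R * x).
apply/eqP; rewrite eq_complex /=; apply/andP; split; apply/eqP; ring.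
Qed.

(** For k > 0 the complex identity says that the pair (cosI, sinI) of phi is that of f divided by
    psi(k) and rotated by th; here the rotation is undone. Negative k give nothing new for real
    functions. *)
Lemma derivative_coef (psi : R -> R) (beta : R) (f phi : R -> R) (k : nat) :
  (0 < k)%N -> 0 < psi k%:R -> psi_beta_derivative psi beta f phi ->
  let th := beta * pi / 2 in
  cosI f k%:R = psi k%:R * (cosI phi k%:R * cos th - sinI phi k%:R * sin th) /\
  sinI f k%:R = psi k%:R * (cosI phi k%:R * sin th + sinI phi k%:R * cos th).
Proof.
move=> k0 pk [_ /(_ k%:Z)] + th; have pi0 := pi_gt0 R.
rewrite gt_eqF// !fourier_nat gtr0_sg ?ltz_nat// mulr1z /expi mulr1 -/th /=.
move=> /eqP; rewrite eq_complex/= => /andP[/eqP h1 /eqP h2].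
have npk : psi k%:R != 0 by rewrite gt_eqF.
have npi : pi != 0 :> R by rewrite gt_eqF.
have e1 : cosI phi k%:R * psi k%:R = cosI f k%:R * cos th + sinI f k%:R * sin th.
  apply: (mulIf (_ : (2 * pi)^-1 * (psi k%:R)^-1 != 0)).
    by rewrite mulf_neq0// invr_eq0 gt_eqF// mulr_gt0.
  transitivity (cosI phi k%:R / (2 * pi)).
    by rewrite -mulrA [psi _ * _]mulrC divfK.
  by rewrite h1; ring.
have e2 : sinI phi k%:R * psi k%:R = sinI f k%:R * cos th - cosI f k%:R * sin th.
  apply: (mulIf (_ : (2 * pi)^-1 * (psi k%:R)^-1 != 0)).
    by rewrite mulf_neq0// invr_eq0 gt_eqF// mulr_gt0.
  transitivity (- - (sinI phi k%:R / (2 * pi))).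
    by rewrite opprK -mulrA [psi _ * _]mulrC divfK.
  by rewrite h2; ring.
have cs := cos2Dsin2 th.
split.
  transitivity (cosI f k%:R * (cos th ^+ 2 + sin th ^+ 2)); first by rewrite cs mulr1.
  transitivity (cosI phi k%:R * psi k%:R * cos th - sinI phi k%:R * psi k%:R * sin th); last by ring.
  by rewrite e1 e2; ring.
transitivity (sinI f k%:R * (cos th ^+ 2 + sin th ^+ 2)); first by rewrite cs mulr1.
transitivity (cosI phi k%:R * psi k%:R * sin th + sinI phi k%:R * psi k%:R * cos th); last by ring.
by rewrite e1 e2; ring.
Qed.

Lemma sum_trigI_conv (phi : R -> R) (r : seq nat) (w : nat -> R) (th x : R) :
  mu.-integrable D (EFin \o phi) ->
  \sum_(k <- r) w k * (cosI phi k%:R * cos (k%:R * x - th) +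
    sinI phi k%:R * sin (k%:R * x - th)) =
  \int[mu]_(t in D) (phi t * \sum_(k <- r) w k * cos (k%:R * (x - t) - th)).
Proof.
move=> fi; have mD : measurable D by [].
pose h k t := w k * cos (k%:R * x - th) * (phi t * cos (k%:R * t)) +
              w k * sin (k%:R * x - th) * (phi t * sin (k%:R * t)).
have iZ z g : mu.-integrable D (EFin \o g) -> mu.-integrable D (EFin \o (fun t => z * g t)).
  move=> gi; have := integrableZl mD z gi.
  by apply: eq_integrable => // t _; rewrite /= EFinM.
have hi k : mu.-integrable D (EFin \o h k).
  have := integrableD mD (iZ (w k * cos (k%:R * x - th)) _ (integrableM_cos k%:R fi))
    (iZ (w k * sin (k%:R * x - th)) _ (integrableM_sin k%:R fi)).
  by apply: eq_integrable => // t _; rewrite /= EFinD.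
transitivity (\int[mu]_(t in D) \sum_(k <- r) h k t).
  rewrite Rintegral_sum//; apply: eq_bigr => k _.
  rewrite /h RintegralD//; [|exact/iZ/integrableM_cos|exact/iZ/integrableM_sin].
  rewrite !RintegralZl//; [|exact: integrableM_sin|exact: integrableM_cos].
  by rewrite -/(cosI phi k%:R) -/(sinI phi k%:R); ring.
apply: eq_Rintegral => t _; rewrite mulr_sumr; apply: eq_bigr => k _.
have -> : k%:R * (x - t) - th = (k%:R * x - th) - k%:R * t by ring.
by rewrite cosB /h; ring.
Qed.

Section class.
Variables (psi : R -> R) (p beta : R).
Hypothesis p1 : 1 < p.
Hypothesis Hpsi : frakM_second_infty psi.

Let q := p / (p - 1).

Let q1 : 1 < q.
Proof. by move: p1 => h; rewrite /q ltr_pdivlMr; lra. Qed.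

Let pq : p^-1 + q^-1 = 1.
Proof. by move: p1 => h; rewrite /q; field; apply/andP; split; rewrite gt_eqF//; lra. Qed.

(** Hoelder's inequality against a function bounded by 1, whose q-norm over a period is at most (2
    pi)^(1/q). It prices the single extra frequency n when 2n frequencies are removed. *)
Lemma cosI_sinI_bound : exists2 c, 0 < c & forall phi (k : R), inL1 phi -> B0p p phi ->
  `|cosI phi k| <= c /\ `|sinI phi k| <= c.
Proof.
have pi0 := pi_gt0 R; have mD : measurable D by [].
have q0 : 0 < q by exact: lt_trans ltr01 q1.
have c0 : 0 < (2 * pi) `^ q^-1 :> R by rewrite powR_gt0// mulr_gt0.
exists ((2 * pi) `^ q^-1) => // phi k phi1 [[pphi mphi _] phip _].
have muD : mu D = (2 * pi)%:E.
  transitivity (mu (`[- pi, pi]%classic : set R)) => //.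
  have pipi : - pi < pi :> R by lra.
  by rewrite lebesgue_measure_itv/= lte_fin pipi -EFinD; congr EFin; ring.
have aux (g : R -> R) : measurable_fun setT g -> (forall t, `|g t| <= 1) ->
    `|\int[mu]_(t in D) (phi t * g t)| <= (2 * pi) `^ q^-1.
  move=> mg g1; apply: (@young_Rintegral R p q) => //; 
    [exact: lt_trans ltr01 p1|by rewrite intp_periodic|].
  rewrite -powRrM mulVf ?gt_eqF// powRr1; last by rewrite mulr_ge0// ltW.
  apply: (@le_trans _ _ (\int[mu]_(x in D) (cst 1%E) x)%E).
    apply: ge0_le_integral => //.
    - apply/measurable_EFinP; apply: measurable_funTS; apply: measurable_fun_powR.
      exact: measurableT_comp.
    - move=> t _; rewrite lee_fin /=.
      apply: (@le_trans _ _ (1 `^ q)); last by rewrite powR1.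
      by rewrite ge0_ler_powR ?nnegrE// ltW.
  by apply: (@le_trans _ _ (mu D)); [rewrite integral_cst// mul1e|rewrite muD].
split; apply: aux; first exact: measurable_cosM.
- by move=> t; exact: cos_max.
- exact: measurable_sinM.
- by move=> t; exact: sin_max.
Qed.

(** The coefficients psi(k) (1 - k/(N+1)) are a product of two nonnegative decreasing sequences, so
    [monotone_kernel_bound] applies with constants that do not depend on N. *)
Lemma class_fejer_tail : exists2 c, 0 < c & forall n f phi N x, (0 < n)%N ->
  inL1 f -> psi_beta_derivative psi beta f phi -> B0p p phi -> - pi <= x <= pi ->
  `|\sum_(n <= k < N.+1) 2 * (1 - k%:R / N.+1%:R) * trigI f k%:R x| <=
  c * (psi n%:R * (etaf psi n%:R - n%:R) `^ p^-1).
Proof.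
have [C C0 HC] := tail_sum Hpsi.
have q0 : 0 < q by exact: lt_trans ltr01 q1.
pose c := 4 * (1 + C) * (8 / (q - 1)) `^ q^-1.
have c8 : 0 < 8 / (q - 1) by rewrite divr_gt0 ?subr_gt0 ?q1.
have c0 : 0 < c by rewrite mulr_gt0 ?powR_gt0// mulr_gt0//; lra.
exists c => // n f phi N x n0 f1 der phiB xpi.
have n1 : 1 <= n%:R :> R by rewrite ler1n.
have pn := psi_gt0 Hpsi n1; set l := etaf psi n%:R - n%:R.
have l0 : 0 < l := etaf_gt Hpsi n1.
have M0 : 0 < c * (psi n%:R * l `^ p^-1) by rewrite mulr_gt0// mulr_gt0// powR_gt0.
have [nN|Nn] := leqP n N.+1; last first.
  by rewrite big_geq ?normr0; [exact: ltW|exact: ltnW].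
pose th := beta * pi / 2.
pose a k := 2 * (1 - k%:R / N.+1%:R) * psi k%:R.
have phi1 : inL1 phi by case: der.
have phii := integrable_periodic phi1.
have [[pphi mphi _] phip _] := phiB.
have nat1 k : (n <= k)%N -> 1 <= k%:R :> R by move=> nk; rewrite ler1n (leq_trans n0).
have -> : \sum_(n <= k < N.+1) 2 * (1 - k%:R / N.+1%:R) * trigI f k%:R x =
  \int[mu]_(t in D) (phi t * \sum_(n <= k < N.+1) a k * cos (k%:R * (x - t) - th)).
  rewrite -sum_trigI_conv// !big_nat; apply: eq_bigr => k /andP[nk _].
  have k0 : (0 < k)%N by exact: leq_trans nk.
  rewrite /trigI; have [-> ->] := derivative_coef k0 (psi_gt0 Hpsi (nat1 _ nk)) der.
  by rewrite cosB sinB -/th /a; ring.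
(* The 1 serves the bound a k <= 2 psi(n), the [C] of [tail_sum] the bound of the sum by 2 C psi(n)
   l. *)
pose B := 2 * (1 + C) * psi n%:R.
have w01 k : (n <= k <= N.+1)%N -> 0 <= (1 - k%:R / N.+1%:R : R) <= 1.
  move=> /andP[_ kN]; rewrite subr_ge0 ler_pdivrMr// mul1r ler_nat kN/=.
  by rewrite lerBlDr lerDl divr_ge0.
have psik k : (n <= k)%N -> 0 < psi k%:R <= psi n%:R.
  move=> nk; rewrite psi_gt0 ?nat1//=; apply: frakM_nincr => //.
    exact: psi_frakM.
  by rewrite ler_nat.
have a2 k : (n <= k <= N.+1)%N -> 0 <= a k <= 2 * psi k%:R.
  move=> /[dup] /w01/andP[w0 w1] /andP[/psik/andP[pk _] _].
  rewrite /a; apply/andP; split; first by rewrite !mulr_ge0// ltW.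
  by rewrite -mulrA ler_pM2l// ler_piMl// ltW.
have kb y : `|\sum_(n <= k < N.+1) a k * cos (k%:R * y + - th)| *
    (1 + l * `|sin (y / 2)|) <= 2 * B * l.
  apply: monotone_kernel_bound => //; first exact: ltW.
  - move=> k kn; have /andP[-> ak] := a2 _ kn; apply: (le_trans ak).
    have /andP[/psik/andP[pk pkn] _] := kn.
    by rewrite /B -mulrA ler_pM2l//; nra.
  - right=> k /andP[nk kN]; rewrite /a.
    have /andP[v0 v1] := w01 k ltac:(by rewrite nk ltnW).
    have /andP[w0 w1] := w01 k.+1 ltac:(by rewrite leqW).
    apply: ler_pM; rewrite ?mulr_ge0//.
    + by rewrite ltW//; have /andP[] := psik k.+1 (leqW nk).
    + by rewrite ler_pM2l// lerD2l lerN2 ler_pM2r ?invr_gt0// ler_nat.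
    + by apply: frakM_nincr; [exact: psi_frakM|exact: nat1|rewrite ler_nat].
  - apply: (@le_trans _ _ (2 * \sum_(n <= k < N.+1) psi k%:R)).
      rewrite mulr_sumr !big_nat; apply: ler_sum => k /andP[nk kN].
      by have /andP[_] := a2 k ltac:(by rewrite nk ltnW).
    have := HC n N.+1 n0; rewrite -/l /B => h.
    have : 0 <= psi n%:R * l by rewrite mulr_ge0// ltW.
    lra.
have mK : measurable_fun setT (fun y : R => \sum_(n <= k < N.+1) a k * cos (k%:R * y + - th)).
  apply: measurable_sum => k; apply: measurable_funM => //.
  exact: measurable_cos_affine.
apply: (@young_Rintegral R p q) => //; first exact: lt_trans ltr01 p1.
- by apply: (measurableT_comp mK); exact: measurable_funB.
- by rewrite intp_periodic.
apply: (le_trans (conv_kernel_le q1 l0 xpi mK kb)).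
rewrite lee_fin.
have -> : c * (psi n%:R * l `^ p^-1) = 2 * B * l * (8 / (q - 1) / l) `^ q^-1.
  have c8' : 0 <= 8 / (q - 1) by exact: ltW.
  rewrite (powRM _ c8') ?invr_ge0 ?(ltW l0)//.
  have -> : l `^ p^-1 = l * l^-1 `^ q^-1.
    have -> : p^-1 = 1 - q^-1 by rewrite -pq addrK.
    rewrite powRD; last by rewrite (gt_eqF l0) implybT.
    by rewrite powRr1 ?(ltW l0)// powRN -[l^-1]powR_inv1 ?(ltW l0)// -powRrM mulN1r powRN.
  by rewrite /c /B; ring.
have B0 : 0 <= 2 * B by rewrite /B mulr_ge0// mulr_ge0 ?(ltW pn)// mulr_ge0//; lra.
rewrite [leRHS](powRM _ (mulr_ge0 B0 (ltW l0))) ?powR_ge0//.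
by rewrite -powRrM mulVf ?gt_eqF// powRr1// divr_ge0// ltW.
Qed.

Lemma e_orth_upper : exists2 c, 0 < c & forall n f, (0 < n)%N ->
  Lclass psi beta p f ->
  (e_orth (2 * n - 1) f <= (c * (psi n%:R * (etaf psi n%:R - n%:R) `^ p^-1))%:E)%E /\
  (e_orth (2 * n) f <= (c * (psi n%:R * (etaf psi n%:R - n%:R) `^ p^-1))%:E)%E.
Proof.
have pi0 := pi_gt0 R.
have [c c0 Hc] := class_fejer_tail.
have [c' c'0 Hc'] := cosI_sinI_bound.
have [K K0 HK] := etaf_gap Hpsi.
have Kp0 : 0 < K `^ p^-1 by rewrite powR_gt0.
(* c is for the tail. The 8 is for frequency n: |a| + |b| <= 4 c' psi(n), counted once in the real
   and once in the imaginary part, and psi(n) <= M / K^(1/p) because l >= K. *)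
pose e := (c + 8 * c' / K `^ p^-1) / (2 * pi).
have e0 : 0 < e by rewrite divr_gt0 ?mulr_gt0// addr_gt0// divr_gt0// mulr_gt0.
exists e => // n f n0 [f1 [phi [der phiB]]].
have n1 : 1 <= n%:R :> R by rewrite ler1n.
have pn := psi_gt0 Hpsi n1; set l := etaf psi n%:R - n%:R.
have l0 : 0 < l := etaf_gt Hpsi n1.
have sz : (2 * n.-1 + 1 = 2 * n - 1)%N by clear -n0; lia.
have fi := integrable_periodic f1.
have [pf mf _] := f1.
set M := psi n%:R * l `^ p^-1.
have M0 : 0 < M by rewrite mulr_gt0// powR_gt0.
pose S x := cosI f 0 + \sum_(1 <= k < n) 2 * trigI f k%:R x.
have ae : {ae mu, forall x, x \in `[0, 2 * pi] -> `|2 * pi * f x - S x| <= c * M}.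
  apply: ae_periodic.
    move=> x; rewrite pf /S; under eq_bigr do rewrite trigI_periodic.
    by [].
  by apply: fejer_ae_bound => // N x xpi; exact: (Hc _ _ phi).
have dvd x : f x - S x / (2 * pi) = (2 * pi * f x - S x) / (2 * pi).
  by rewrite mulrBl [2 * pi * f x]mulrC mulfK// gt_eqF// mulr_gt0.
have t0 : 0 < (2 * pi : R)^-1 by rewrite invr_gt0 mulr_gt0.
have le1 x : `|2 * pi * f x - S x| <= c * M -> `|f x - S x / (2 * pi)| <= c * M / (2 * pi).
  by move=> h; rewrite dvd normrM (gtr0_norm t0) ler_pM2r.
have psiM : psi n%:R <= M / K `^ p^-1.
  rewrite ler_pdivlMr// /M ler_pM2l//.
  by rewrite ge0_ler_powR ?nnegrE ?(ltW K0) ?(ltW l0) ?HK// invr_ge0 ltW// (lt_trans ltr01 p1).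
have sumE x : \sum_(k <- symm_int n.-1) fourier f k * expi (k%:~R * x) = ((S x / (2 * pi))%:C)%C.
  by rewrite fourier_rem_symm// prednK.
split.
- apply: (@le_trans _ _ (supnorm (fourier_rem f (symm_int n.-1)))).
    apply: ereal_inf_lbound; exists (symm_int n.-1) => //.
    by split; [exact: symm_int_uniq|rewrite size_symm_int sz].
  apply: ereal_inf_lbound => /=; move: ae.
  apply: filterS; first exact: (ae_filter_ringOfSetsType mu).
  move=> x + xI => /(_ xI) h; rewrite lee_fin /fourier_rem sumE -raddfB/=.
  apply: (le_trans (cmod_le _ _)); rewrite normr0 addr0.
  apply: (le_trans (le1 _ h)); rewrite /e [leLHS]mulrAC (ler_pM2r M0).
  by rewrite ler_pM2r// lerDl divr_ge0// ?mulr_ge0// ltW.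
(* The 2n-th frequency is n without its partner -n, so this remainder is no longer real. *)
- apply: (@le_trans _ _ (supnorm (fourier_rem f (n%:Z :: symm_int n.-1)))).
    apply: ereal_inf_lbound; exists (n%:Z :: symm_int n.-1) => //; split => /=.
      by rewrite symm_int_uniq andbT; apply/negP => /symm_int_le; clear -n0; lia.
    by rewrite size_symm_int sz; clear -n0; lia.
  apply: ereal_inf_lbound => /=; move: ae.
  apply: filterS; first exact: (ae_filter_ringOfSetsType mu).
  move=> x + xI => /(_ xI) h; rewrite lee_fin /fourier_rem big_cons sumE.
  rewrite fourier_nat /expi -[n%:~R]/(n%:R).
  set a := cosI f n%:R; set b := sinI f n%:R.
  set C := cos (n%:R * x); set s := sin (n%:R * x).
  have [aE bE] := derivative_coef n0 pn der.
  have [ca sa] := Hc' phi n%:R der.1 phiB.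
  have le2 (u v y z : R) : `|u| <= c' -> `|v| <= c' -> `|y| <= 1 -> `|z| <= 1 ->
      `|u * y + v * z| <= 2 * c'.
    move=> uc vc y1 z1; apply: (le_trans (ler_normD _ _)); rewrite !normrM.
    have : `|u| * `|y| <= c' * 1 by apply: ler_pM.
    have : `|v| * `|z| <= c' * 1 by apply: ler_pM.
    lra.
  have al : `|a| <= psi n%:R * (2 * c').
    by rewrite /a aE normrM (gtr0_norm pn) ler_pM2l// -mulrN le2 ?normrN ?cos_max ?sin_max.
  have bl : `|b| <= psi n%:R * (2 * c').
    by rewrite /b bE normrM (gtr0_norm pn) ler_pM2l// le2 ?cos_max ?sin_max.
  set d := f x - S x / (2 * pi).
  have -> : ((f x)%:C - ((a / (2 * pi) -i* (b / (2 * pi))) * (C +i* s) + (S x / (2 * pi))%:C))%C =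
    ((d - (a * C + b * s) / (2 * pi)) +i* (- (a * s - b * C) / (2 * pi)))%C.
    by apply/eqP; rewrite eq_complex /= /d; apply/andP; split; apply/eqP; ring.
  apply: (le_trans (cmod_le _ _)).
  have t1 : `|a * C + b * s| <= `|a| + `|b|.
    by apply: (le_trans (ler_normD _ _)); rewrite !normrM lerD// ler_piMr// ?cos_max ?sin_max.
  have t2 : `|a * s - b * C| <= `|a| + `|b|.
    by apply: (le_trans (ler_normB _ _)); rewrite !normrM lerD// ler_piMr// ?cos_max ?sin_max.
  have dl := le1 _ h; rewrite -/d in dl.
  have u1 : `|d - (a * C + b * s) / (2 * pi)| <= c * M / (2 * pi) + (`|a| + `|b|) / (2 * pi).
    apply: (le_trans (ler_normB _ _)); rewrite lerD// normrM (gtr0_norm t0).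
    by rewrite ler_pM2r.
  have u2 : `|- (a * s - b * C) / (2 * pi)| <= (`|a| + `|b|) / (2 * pi).
    by rewrite normrM normrN (gtr0_norm t0) ler_pM2r.
  apply: (le_trans (lerD u1 u2)).
  rewrite -!mulrDl /e [leRHS]mulrAC ler_pM2r//.
  rewrite mulrDl -addrA lerD2l.
  have -> : 8 * c' / K `^ p^-1 * M = M / K `^ p^-1 * (8 * c') by ring.
  apply: (@le_trans _ _ (psi n%:R * (8 * c'))); last by rewrite ler_pM2r// mulr_gt0.
  lra.
Qed.

End class.
End upper.

(** * The lower bound *)

Lemma Re_le_cmod (R : realType) (a b : R) : a <= cmod (a +i* b)%C.
Proof.
rewrite /cmod/=; apply: (le_trans (ler_norm a)).
by rewrite -sqrtr_sqr ler_wsqrtr// lerDl sqr_ge0.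
Qed.

Section lower.
Variable R : realType.
Local Notation mu := (@lebesgue_measure R).
Local Notation D := (`[- pi, pi]%classic : set (measurableTypeR R)).

(** A smaller essential bound would fail on a whole interval [0, d], by continuity of the real part
    at 0, and that interval has positive measure. It is one-sided because [supnorm] only sees
    [0, 2 pi]. *)
Lemma supnorm_ge (u v : R -> R) (c : R) : {for 0, continuous u} -> c <= u 0 ->
  (c%:E <= supnorm (fun x => (u x +i* v x)%C))%E.
Proof.
move=> cu cu0; have pi0 := pi_gt0 R.
apply: le_ereal_inf_tmp => y /= hy; rewrite leNgt; apply/negP => yc.
have [r ry rc] : exists2 r : R, (y <= r%:E)%E & r < c.
  case: y yc {hy} => [r|//|_]; first by rewrite lte_fin => rc; exists r.
  by exists (c - 1); [exact: leNye|rewrite ltrBlDr ltrDl].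
have ru : r < u 0 by exact: lt_le_trans cu0.
have /cvgrPdist_lt/(_ (u 0 - r)) := cu; rewrite subr_gt0 => /(_ ru) [e /= e0 he].
pose d := Num.min (e / 2) pi.
have d0 : 0 < d by rewrite lt_min divr_gt0.
have [A [mA A0 sA]] := hy.
have sub : `[0, d]%classic `<=` A.
  move=> x /=; rewrite in_itv/= => /andP[x0]; rewrite le_min => /andP[xe xp].
  apply: sA => /= /(_ ltac:(rewrite in_itv/=; apply/andP; split; lra)).
  apply/negP; rewrite -ltNge; apply: (le_lt_trans ry); rewrite lte_fin.
  apply: lt_le_trans (Re_le_cmod _ _).
  have := he x; rewrite /ball_/= sub0r normrN ger0_norm// => /(_ ltac:(lra)).
  by rewrite ltr_norml => /andP[_]; lra.
have : (mu `[0%R, d] <= mu A)%E by apply: le_measure; rewrite ?inE.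
rewrite A0 lebesgue_measure_itv/= lte_fin d0 -EFinD lee_fin oppr0 addr0.
by rewrite leNgt d0.
Qed.

Lemma Rintegral_cos (m : int) (t : R) :
  \int[mu]_(x in D) cos (m%:~R * x + t) = if m == 0 then 2 * pi * cos t else 0.
Proof.
have pi0 := pi_gt0 R; have pipi : - pi < pi :> R by lra.
have [->|m0] := eqVneq m 0.
  under eq_Rintegral do rewrite mul0r add0r.
  rewrite Rintegral_cst// [X in _ * fine X](_ : _ = (2 * pi)%:E); last first.
    transitivity (mu (`[- pi, pi]%classic : set R)) => //.
    by rewrite lebesgue_measure_itv/= lte_fin pipi -EFinD; congr EFin; ring.
  by rewrite /= mulrC.
have mR0 : (m%:~R : R) != 0 by rewrite intr_eq0.
have dF (x : R) : is_derive x 1 (fun y => m%:~R^-1 * sin (m%:~R * y + t))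
    (cos (m%:~R * x + t)).
  have := is_derive_scale (m%:~R^-1) (is_derive_sin_affine m%:~R t x).
  by rewrite mulrA mulVf// mul1r.
rewrite /Rintegral (@continuous_FTC2_is_derive _ (fun y => m%:~R^-1 * sin (m%:~R * y + t)))//.
- rewrite /= -mulrBr mulrN sinD [sin (- _ + t)]sinD sinN cosN.
  have -> : sin (m%:~R * pi) = 0 :> R.
    case: m {m0 mR0 dF} => k; first by exact: sin_nat_pi.
    by rewrite NegzE mulrNz mulNr sinN (sin_nat_pi _ k.+1) oppr0.
  by ring.
- apply: continuous_subspaceT => x.
  have /derivable1_diffP/differentiable_continuous : derivable (fun x : R => cos (m%:~R * x + t)) x 1.
    by apply: ex_derive; exact: is_derive_cos_affine.
  exact.
Qed.

Lemma integrable_cos_affine (c t : R) :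
  mu.-integrable D (EFin \o (fun x => cos (c * x + t))).
Proof.
apply: continuous_compact_integrable; first exact: segment_compact.
apply: continuous_subspaceT => x.
have /derivable1_diffP/differentiable_continuous : derivable (fun x : R => cos (c * x + t)) x 1.
  by apply: ex_derive; exact: is_derive_cos_affine.
exact.
Qed.

(** For j = k = 0 both indicators are 1, so the double mass of the constant term needs no separate
    case. *)
Lemma Rintegral_cos_cos (j : nat) (k : int) (t : R) :
  \int[mu]_(x in D) (cos (j%:R * x + t) * cos (k%:~R * x)) =
  ((j%:Z + k == 0)%:R + (j%:Z - k == 0)%:R) * (pi * cos t).
Proof.
have mD : measurable D by [].
transitivity (\int[mu]_(x in D) (2^-1 *
  (cos ((j%:Z + k)%:~R * x + t) + cos ((j%:Z - k)%:~R * x + t)))).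
  apply: eq_Rintegral => x _; rewrite intrD intrB.
  have -> : (j%:~R + k%:~R) * x + t = (j%:R * x + t) + k%:~R * x :> R by ring.
  have -> : (j%:~R - k%:~R) * x + t = (j%:R * x + t) - k%:~R * x :> R by ring.
  by move: (_ * x + t) (k%:~R * x) => A B; rewrite cosD cosB; field.
rewrite RintegralZl//; last first.
  have := integrableD mD (integrable_cos_affine (j%:Z + k)%:~R t)
    (integrable_cos_affine (j%:Z - k)%:~R t).
  by apply: eq_integrable => // x _; rewrite /= EFinD.
rewrite RintegralD//; [|exact: integrable_cos_affine|exact: integrable_cos_affine].
rewrite !Rintegral_cos; case: eqP => _; case: eqP => _ /=; by field.
Qed.

Lemma Rintegral_cos_sin (j : nat) (k : int) (t : R) :
  \int[mu]_(x in D) (cos (j%:R * x + t) * sin (k%:~R * x)) =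
  ((j%:Z + k == 0)%:R - (j%:Z - k == 0)%:R) * (pi * sin t).
Proof.
have mD : measurable D by [].
pose t' := t - pi / 2.
have ct y : cos (y + t') = sin (y + t).
  by rewrite /t' addrA cosB cos_pihalf sin_pihalf mulr0 add0r mulr1.
transitivity (\int[mu]_(x in D) (2^-1 *
  (cos ((j%:Z + k)%:~R * x + t') - cos ((j%:Z - k)%:~R * x + t')))).
  apply: eq_Rintegral => x _; rewrite !ct intrD intrB.
  have -> : (j%:~R + k%:~R) * x + t = (j%:R * x + t) + k%:~R * x :> R by ring.
  have -> : (j%:~R - k%:~R) * x + t = (j%:R * x + t) - k%:~R * x :> R by ring.
  by move: (_ * x + t) (k%:~R * x) => A B; rewrite sinD sinB; field.
rewrite RintegralZl//; last first.
  have := integrableB mD (integrable_cos_affine (j%:Z + k)%:~R t')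
    (integrable_cos_affine (j%:Z - k)%:~R t').
  by apply: eq_integrable => // x _; rewrite /= EFinB.
rewrite RintegralB//; [|exact: integrable_cos_affine|exact: integrable_cos_affine].
have <- : cos t' = sin t by have := ct 0; rewrite !add0r.
rewrite !Rintegral_cos; case: eqP => _; case: eqP => _ /=; by field.
Qed.

(** * Fourier coefficients of cosine polynomials *)

Section cos_poly.
Variables (a : nat -> R) (N : nat) (t : R).

(** All frequencies share one phase: t = 0 gives the extremal polynomial and t = beta pi / 2 its
    (psi, beta)-derivative. *)
Definition cos_poly (x : R) : R := \sum_(0 <= j < N.+1) a j * cos (j%:R * x + t).

Lemma continuous_cos_poly : continuous cos_poly.
Proof.
move=> x; have /derivable1_diffP/differentiable_continuous : derivable cos_poly x 1.
  apply: ex_derive; apply: is_derive_sumr => j; exact: is_derive_scale.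
exact.
Qed.

Lemma measurable_cos_poly : measurable_fun setT cos_poly.
Proof. by apply: continuous_measurable_fun; exact: continuous_cos_poly. Qed.

Lemma inL1_cos_poly : inL1 cos_poly.
Proof.
split; [|exact: measurable_cos_poly|].
  move=> x; apply: eq_bigr => j _; congr (_ * _).
  by rewrite !cosD cosD2pi_nat sinD2pi_nat.
apply: continuous_compact_integrable; first exact: segment_compact.
by apply: continuous_subspaceT; exact: continuous_cos_poly.
Qed.

Let cos_polyM (g : R -> R) : measurable_fun setT g -> (forall x, `|g x| <= 1) ->
  \int[mu]_(x in D) (cos_poly x * g x) =
  \sum_(0 <= j < N.+1) a j * \int[mu]_(x in D) (cos (j%:R * x + t) * g x).
Proof.
move=> mg g1; have mD : measurable D by [].
have ig (j : nat) : mu.-integrable D (EFin \o (fun x => cos (j%:R * x + t) * g x)).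
  by apply: (@integrableM_bounded _ _ _ 1) => //; exact: integrable_cos_affine.
transitivity (\int[mu]_(x in D) \sum_(0 <= j < N.+1) a j * (cos (j%:R * x + t) * g x)).
  apply: eq_Rintegral => x _; rewrite mulr_suml; apply: eq_bigr => j _.
  by rewrite mulrA.
rewrite Rintegral_sum; first by apply: eq_bigr => j _; rewrite RintegralZl.
move=> j; have := integrableZl mD (a j) (ig j).
by apply: eq_integrable => // x _; rewrite /= EFinM.
Qed.

Let ck k := if (`|k| <= N)%N then a `|k|%N else 0.

Let sum_delta (k : nat) : \sum_(0 <= j < N.+1) a j * (j == k)%:R = if (k <= N)%N then a k else 0.
Proof.
case: leqP => kN.
  rewrite (bigD1_seq k) ?mem_index_iota ?iota_uniq//= eqxx mulr1.
  by rewrite big1 ?addr0// => j /negPf->; rewrite mulr0.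
rewrite big_nat big1// => j jN; rewrite (_ : (j == k) = false) ?mulr0//.
by apply/eqP; lia.
Qed.

Let sum_deltaN (k : int) : k != 0 ->
  \sum_(0 <= j < N.+1) a j * (j%:Z + k == 0)%:R = if k < 0 then ck k else 0.
Proof.
move=> k0; rewrite /ck; case: ltP => hk.
  by rewrite -sum_delta; apply: eq_bigr => j _; congr (_ * _%:R); congr nat_of_bool; lia.
by apply: big1 => j _; rewrite (_ : (_ == _) = false) ?mulr0//; lia.
Qed.

Let sum_deltaP (k : int) : k != 0 ->
  \sum_(0 <= j < N.+1) a j * (j%:Z - k == 0)%:R = if k < 0 then 0 else ck k.
Proof.
move=> k0; rewrite /ck; case: ltP => hk.
  by apply: big1 => j _; rewrite (_ : (_ == _) = false) ?mulr0//; lia.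
by rewrite -sum_delta; apply: eq_bigr => j _; congr (_ * _%:R); congr nat_of_bool; lia.
Qed.

Lemma fourier_cos_poly (k : int) : fourier cos_poly k =
  if k == 0 then ((a 0%N * cos t)%:C)%C
  else ((((if (`|k| <= N)%N then a `|k|%N else 0) / 2)%:C)%C * expi (t * (Num.sg k)%:~R)).
Proof.
have pi0 := pi_gt0 R; have npi : pi != 0 :> R by rewrite gt_eqF.
have cancel_pi (u v : R) : u * (pi * v) / (2 * pi) = u * v / 2.
  by rewrite mulrCA [2 * pi]mulrC -mulf_div divff// mul1r.
rewrite /fourier.
rewrite (cos_polyM (g := fun x => cos (k%:~R * x))); first last.
- by move=> x; exact: cos_max.
- exact: measurable_cosM.
rewrite (cos_polyM (g := fun x => sin (k%:~R * x))); first last.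
- by move=> x; exact: sin_max.
- exact: measurable_sinM.
under eq_bigr do rewrite Rintegral_cos_cos mulrA mulrDr.
under [X in (_ -i* (X / _))%C]eq_bigr do rewrite Rintegral_cos_sin mulrA mulrBr.
rewrite -mulr_suml big_split/= -mulr_suml sumrB.
have [->|k0] := eqVneq k 0.
  have E1 : \sum_(0 <= i < N.+1) a i * (i%:Z + 0 == 0)%:R = a 0%N.
    by rewrite -[RHS](sum_delta 0); apply: eq_bigr => j _; rewrite addr0.
  have E2 : \sum_(0 <= i < N.+1) a i * (i%:Z - 0 == 0)%:R = a 0%N.
    by rewrite -[RHS](sum_delta 0); apply: eq_bigr => j _; rewrite subr0.
  rewrite ?E1 ?E2 subrr mul0r mul0r oppr0; congr (_ +i* _)%C.
  by rewrite cancel_pi; field.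
rewrite sum_deltaN// sum_deltaP// -/(ck k).
apply/eqP; rewrite eq_complex /= /expi.
case: ltP => hk.
  rewrite ltr0_sg// mulrN1z mulrN1 cosN sinN.
  by rewrite !cancel_pi; apply/andP; split; apply/eqP; field.
rewrite gtr0_sg ?lt_neqAle ?hk 1?eq_sym ?k0// mulr1z mulr1.
by rewrite !cancel_pi; apply/andP; split; apply/eqP; field.
Qed.

End cos_poly.

Section class.
Variables (psi : R -> R) (p beta : R).
Hypothesis p1 : 1 < p.
Hypothesis Hpsi : frakM_second_infty psi.
Hypothesis psi_derivable : forall t : R, 1 <= t -> derivable psi t 1.
Hypothesis Hlambda : incr_to_infty (fun t => psi t / `|derive1 psi t|).

(* The derivative of the extremal polynomial of the lower bound. *)
Lemma extremal_kernel : exists2 b, 0 < b & forall (n : nat) (c y : R)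
    (N := (n + (Num.truncn (etaf psi n%:R - n%:R)).+1)%N),
  (0 < n)%N -> 0 < c ->
  `|\sum_(1 <= j < N.+1) 2 * c / psi j%:R * cos (j%:R * y + beta * pi / 2)| *
    (1 + (etaf psi n%:R - n%:R) * `|sin (y / 2)|) <=
  c * b / psi n%:R * (etaf psi n%:R - n%:R).
Proof.
have [E E0 HE] := psi_shift Hpsi.
have [K K0 HK] := etaf_gap Hpsi.
have ln20 : 0 < ln 2 :> R by rewrite ln_gt0// ltr1n.
(* 1 / ln 2 comes from the sum over k < n. For n <= k <= N there are at most l + 2 <= (1 + 2/K) l
   terms, each at most E / psi(n). The same number also bounds the largest coefficient. *)
pose b' := 2 * ((ln 2)^-1 + E * (1 + 2 / K)).
have Kp : 0 < 2 / K by rewrite divr_gt0.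
have lp : 0 < (ln 2 : R)^-1 by rewrite invr_gt0.
have EK : 0 < E * (2 / K) by rewrite mulr_gt0.
have b'0 : 0 < b' by rewrite /b' mulr_gt0// mulrDr mulr1; lra.
exists (2 * b') => [|n c y N n0 c0]; first by rewrite mulr_gt0.
have n1 : 1 <= n%:R :> R by rewrite ler1n.
have pn := psi_gt0 Hpsi n1; set l := etaf psi n%:R - n%:R in N *.
have l0 : 0 < l := etaf_gt Hpsi n1.
have Kl : K <= l := HK _ n1.
have lN : (Num.truncn l)%:R <= l by rewrite truncn_le// ltW.
have etaN : N.+1%:R <= etaf psi n%:R + 2.
  rewrite /N -addnS natrD -addn2 natrD.
  have -> : etaf psi n%:R = n%:R + l by rewrite /l; ring.
  lra.
have nat1 k : (0 < k)%N -> 1 <= k%:R :> R by rewrite ler1n.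
have invE k : (0 < k)%N -> (k <= N.+1)%N -> (psi k%:R)^-1 <= E / psi n%:R.
  move=> k0 kN; have pk := psi_gt0 Hpsi (nat1 _ k0).
  have : psi n%:R <= E * psi k%:R.
    apply: (le_trans (HE _ n1)); rewrite ler_pM2l//.
    apply: frakM_nincr; [exact: psi_frakM|exact: nat1|].
    by apply: le_trans etaN; rewrite ler_nat.
  by move=> h; rewrite -[(psi k%:R)^-1]mul1r ler_pdivrMr// mulrAC ler_pdivlMr// mul1r.
have -> : c * (2 * b') / psi n%:R * l = 2 * (c * b' / psi n%:R) * l by ring.
apply: monotone_kernel_bound => //.
- exact: ltW.
- move=> k /andP[k0 kN]; have pk := psi_gt0 Hpsi (nat1 _ k0).
  apply/andP; split; first by rewrite !mulr_ge0 ?invr_ge0// ltW.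
  have -> : 2 * c / psi k%:R = c * (2 * (psi k%:R)^-1) by ring.
  rewrite -mulrA ler_pM2l//.
  have := invE _ k0 kN => h.
  apply: (@le_trans _ _ (2 * E / psi n%:R)); first by lra.
  rewrite ler_pM2r ?invr_gt0// /b' ler_pM2l// mulrDr mulr1; lra.
- left=> k /andP[k0 kN]; have pk := psi_gt0 Hpsi (nat1 _ k0).
  have pk1 : 0 < psi k.+1%:R by rewrite psi_gt0// nat1.
  rewrite ler_pM2l ?mulr_gt0// lef_pV2 ?posrE//.
  by apply: frakM_nincr; [exact: psi_frakM|exact: nat1|rewrite ler_nat].
- have nN : (n <= N.+1)%N by rewrite /N -addnS leq_addr.
  have -> : \sum_(1 <= k < N.+1) 2 * c / psi k%:R = 2 * c * \sum_(1 <= k < N.+1) (psi k%:R)^-1.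
    by rewrite mulr_sumr; apply: eq_bigr.
  have s1 := sum_inv_psi Hpsi psi_derivable Hlambda n0; rewrite -/l in s1.
  have s2 : \sum_(n <= k < N.+1) (psi k%:R)^-1 <= (l + 2) * (E / psi n%:R).
    apply: (@le_trans _ _ (\sum_(n <= k < N.+1) (E / psi n%:R))).
      rewrite !big_nat; apply: ler_sum => k /andP[nk kN].
      by apply: invE; [exact: leq_trans nk|exact: ltnW].
    rewrite sumr_const_nat -[leLHS]mulr_natl ler_pM2r ?divr_gt0//.
    have -> : (N.+1 - n = Num.truncn l + 2)%N by rewrite /N -addnS addKn addn2.
    by rewrite natrD lerD2r.
  rewrite (big_cat_nat (n := n))//=.
  have -> : c * b' / psi n%:R * l = 2 * c * ((l / ln 2 + (l + 2 / K * l) * E) / psi n%:R).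
    by rewrite /b'; field; rewrite !gt_eqF.
  rewrite ler_pM2l ?mulr_gt0// mulrDl lerD//; apply: (le_trans s2).
  rewrite mulrA ler_pM2r ?invr_gt0// ler_pM2r// lerD2l.
  by rewrite mulrAC ler_pdivlMr// ler_pM2l.
Qed.

Lemma e_orth_class_lower : exists2 d, 0 < d & forall n m, (0 < n)%N -> (m <= 2 * n)%N ->
  ((d * (psi n%:R * (etaf psi n%:R - n%:R) `^ p^-1))%:E <=
    e_orth_class m (Lclass psi beta p))%E.
Proof.
have pi0 := pi_gt0 R.
have [b b0 Hb] := extremal_kernel.
have p0 : 0 < p := lt_trans ltr01 p1.
have cp : 0 < (p - 1) / 8 by rewrite divr_gt0// subr_gt0.
(* With c = d psi(n) l^(1/p - 1), this value makes the bound of [intp_kernel_le] for phi exactly 1.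
   At 0 the remainder is at least 2 c l, whence the constant 2 d below. *)
pose d := ((p - 1) / 8) `^ p^-1 / b.
have d0 : 0 < d by rewrite divr_gt0// powR_gt0.
exists (2 * d) => [|n m n0 m2n]; first by rewrite mulr_gt0.
have n1 : 1 <= n%:R :> R by rewrite ler1n.
have pn := psi_gt0 Hpsi n1; set l := etaf psi n%:R - n%:R.
have l0 : 0 < l := etaf_gt Hpsi n1.
pose c := d * psi n%:R * l `^ p^-1 / l.
have c0 : 0 < c by rewrite /c divr_gt0// mulr_gt0 ?powR_gt0// mulr_gt0.
pose N := (n + (Num.truncn l).+1)%N.
pose th := beta * pi / 2.
(* cos(j x) splits between j and -j, so 2 c for j > 0 and c for j = 0 make all Fourier coefficients
   of f equal to c. In [ap] the constant term is 0, as the mean of a (psi, beta)-derivative must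
   be. *)
pose af (j : nat) : R := if j == 0%N then c else 2 * c.
pose ap (j : nat) : R := if j == 0%N then 0 else 2 * c / psi j%:R.
pose f := cos_poly af N 0; pose phi := cos_poly ap N th.
have phiE y : phi y = \sum_(1 <= j < N.+1) 2 * c / psi j%:R * cos (j%:R * y + th).
  rewrite /phi /cos_poly big_ltn// {1}/ap/= mul0r add0r.
  by rewrite !big_nat; apply: eq_bigr => j /andP[j0 _]; rewrite /ap gtn_eqF.
have phip : (intp p phi <= 1)%E.
  have hk s : `|phi s| * (1 + l * `|sin (s / 2)|) <= c * b / psi n%:R * l.
    by rewrite phiE; exact: Hb.
  apply: (le_trans (intp_kernel_le p1 l0 (measurable_cos_poly _ _ _) hk)).
  rewrite lee_fin.
  have -> : c * b / psi n%:R * l = ((p - 1) / 8) `^ p^-1 * l `^ p^-1.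
    by rewrite /c /d; field; rewrite !gt_eqF.
  rewrite -powRM ?(ltW cp) ?(ltW l0)// -powRrM mulVf ?gt_eqF// powRr1; last first.
    by rewrite mulr_ge0// ltW.
  rewrite le_eqVlt; apply/orP; left; apply/eqP; field.
  by rewrite gt_eqF//= gt_eqF// subr_gt0.
have expi0 : expi (0 : R) = 1 by rewrite /expi cos0 sin0.
have der : psi_beta_derivative psi beta f phi.
  split; first exact: inL1_cos_poly.
  move=> k; rewrite !fourier_cos_poly.
  case: ifPn => [_|k0]; first by rewrite /ap/= mul0r.
  have kn0 : (`|k|%N == 0%N) = false by rewrite absz_eq0 (negPf k0).
  rewrite /af /ap kn0 mul0r expi0 mulr1 /th.
  congr (_ * _); rewrite -rmorphM/=; congr (_%:C)%C.
  by case: ifP => _; ring.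
have fL : Lclass psi beta p f.
  split; first exact: inL1_cos_poly.
  exists phi; split=> //; split => //.
    split; [|exact: measurable_cos_poly|exact: (le_lt_trans phip (ltry _))].
    by have [] := inL1_cos_poly ap N th.
  have := fourier_cos_poly ap N th 0; rewrite eqxx /fourier /= mul0r => /eqP.
  rewrite eq_complex /= => /andP[/eqP h _].
  have E : \int[mu]_(x in D) (phi x * cos ((0 : int)%:~R * x)) = \int[mu]_(x in D) phi x.
    by apply: eq_Rintegral => x _; rewrite mulr0z mul0r cos0 mulr1.
  move: h => /eqP; rewrite mulf_eq0 invr_eq0 (gt_eqF (mulr_gt0 _ pi0))// orbF => /eqP h.
  by rewrite -[LHS]E; exact: h.
apply: (@le_trans _ _ (e_orth m f)); last by apply: ereal_sup_ubound; exists f.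
apply: le_ereal_inf_tmp => _ [g [ug sg] <-].
(* Removing a frequency beyond N removes nothing, so each of the m removed terms lowers the value at
   0 by at most c. *)
pose w (k : int) : R := if (`|k| <= N)%N then c else 0.
have fE k : fourier f k = ((w k)%:C)%C.
  rewrite fourier_cos_poly; case: ifPn => [/eqP->|k0].
    by rewrite /af /w/= cos0 mulr1.
  have kn0 : (`|k|%N == 0%N) = false by rewrite absz_eq0 (negPf k0).
  rewrite /af kn0 mul0r expi0 mulr1 /w; congr (_%:C)%C.
  by case: ifP => _; field.
pose u x := f x - \sum_(k <- g) w k * cos (k%:~R * x + 0).
pose v x := - \sum_(k <- g) w k * sin (k%:~R * x).
have remE : fourier_rem f g = fun x => (u x +i* v x)%C.
  apply/funext => x; rewrite /fourier_rem.
  have -> : \sum_(k <- g) fourier f k * expi (k%:~R * x) =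
    ((\sum_(k <- g) w k * cos (k%:~R * x + 0)) +i* (\sum_(k <- g) w k * sin (k%:~R * x)))%C.
    elim: g {ug sg u v} => [|k g IH]; first by rewrite !big_nil.
    rewrite !big_cons IH fE /expi addr0.
    by apply/eqP; rewrite eq_complex /=; apply/andP; split; apply/eqP; ring.
  by apply/eqP; rewrite eq_complex /= sub0r !eqxx.
rewrite remE; apply: supnorm_ge.
  apply: cvgB; first exact: continuous_cos_poly.
  have /derivable1_diffP/differentiable_continuous :
      derivable (fun x : R => \sum_(k <- g) w k * cos (k%:~R * x + 0)) 0 1.
    apply: ex_derive; apply: is_derive_sumr => j; exact: is_derive_scale.
  exact.
have f0 : f 0 = c + 2 * c * N%:R.
  rewrite /f /cos_poly big_ltn// {1}/af/= mulr0 addr0 cos0 mulr1; congr (_ + _).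
  rewrite (eq_big_nat _ _ (F2 := fun=> 2 * c)) => [|j /andP[j0 _]].
    by rewrite sumr_const_nat subn1/= mulr_natr.
  by rewrite /af gtn_eqF// mulr0 addr0 cos0 mulr1.
have wg : \sum_(k <- g) w k * cos (k%:~R * 0 + 0) <= c * (2 * n%:R).
  apply: (@le_trans _ _ (c * m%:R)); last by rewrite ler_pM2l// -natrM ler_nat.
  rewrite -sg; elim: g {ug sg u v remE} => [|k g IH]; first by rewrite big_nil mulr0.
  rewrite big_cons mulr0 addr0 cos0 mulr1 -[size (_ :: _)]/((size g).+1).
  rewrite -addn1 natrD mulrDr mulr1 addrC.
  rewrite lerD//; rewrite /w; case: ifP => // _; exact: ltW.
rewrite /u f0.
have lN : l <= (Num.truncn l).+1%:R by rewrite ltW// truncnS_gt.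
have cl : c * l = d * psi n%:R * l `^ p^-1 by rewrite /c divfK// gt_eqF.
have h : c * l <= c * (Num.truncn l).+1%:R by rewrite ler_pM2l.
move: wg h; rewrite cl /N natrD; lra.
Qed.

End class.
End lower.

Theorem theorem1 (R : realType) (p : R) (psi : R -> R) :
  1 < p ->
  frakM_second_infty psi ->
  (forall t : R, 1 <= t -> derivable psi t 1) ->
  incr_to_infty (fun t => psi t / `|derive1 psi t|) ->
  forall beta : R,
    asymp (fun n => psi n%:R * powR (etaf psi n%:R - n%:R) p^-1)
          (fun n => e_orth_class (2 * n - 1) (Lclass psi beta p)) /\
    asymp (fun n => psi n%:R * powR (etaf psi n%:R - n%:R) p^-1)
          (fun n => e_orth_class (2 * n) (Lclass psi beta p)).
Proof.
move=> p1 Hpsi dpsi Hlambda beta.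
have [C1 C10 lower] := e_orth_class_lower beta p1 Hpsi dpsi Hlambda.
have [C2 C20 upper] := e_orth_upper beta p1 Hpsi.
split; exists C1, C2; split => // n n0; split.
- by apply: lower => //; exact: leq_subr.
- by apply: ge_ereal_sup => _ [f fL <-]; exact: (upper n f n0 fL).1.
- exact: lower.
- by apply: ge_ereal_sup => _ [f fL <-]; exact: (upper n f n0 fL).2.
Qed.
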